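(* (i) There exist a functor $\mathfrak{A}^\ddag:\mathbf{H}\times\mathbf{H}_{\mathrm{fd}}^{\mathrm{op}}\to\mathbf{A}_{\mathrm{c}}$ and a natural transformation $\mathfrak{h}^\ddag$, assigning to $(H_1,H_2)$ a family of Hopf-algebra morphisms $\mathfrak{h}^\ddag(H_1,H_2):H_1\to H_2\otimes\mathfrak{A}^\ddag(H_1,H_2)$, such that for every family $\psi:H_1\to H_2\otimes R$ of Hopf-algebra morphisms there is a unique algebra morphism $\hat\psi:\mathfrak{A}^\ddag(H_1,H_2)\to R$ satisfying $\psi=(\mathrm{id}_{H_2}\otimes\hat\psi)\,\mathfrak{h}^\ddag(H_1,H_2)$. (ii) There exist a functor $\mathfrak{A}^\ddag:\mathbf{H}_{\mathrm{fg}}\times\mathbf{H}^{\mathrm{op}}\to\mathbf{proA}_{\mathrm{cfg}}$ and a natural transformation $\mathfrak{h}^\ddag$, assigning to $(H_1,H_2)$ a pro-family of Hopf-algebra morphisms $\mathfrak{h}^\ddag(H_1,H_2):H_1\to H_2\otimes\mathfrak{A}^\ddag(H_1,H_2)$, such that for every pro-family $\psi:H_1\to H_2\otimes R$ of Hopf-algebra morphisms there is a unique pro-morphism $\hat\psi:\mathfrak{A}^\ddag(H_1,H_2)\to R$ satisfying $\psi=(\mathrm{id}_{H_2}\otimes\hat\psi)\,\mathfrak{h}^\ddag(H_1,H_2)$. In both parts, naturality means that $(\mathrm{id}_{H_2}\otimes\mathfrak{A}^\ddag(g,f))\,\mathfrak{h}^\ddag(H_1,H_2)=(f\otimes\mathrm{id})\,\mathfrak{h}^\ddag(H_1',H_2')\,g$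 for all Hopf algebra morphisms $g:H_1\to H_1'$, $f:H_2'\to H_2$ in the respective categories.
   Context: Fix a field $\mathbb{K}$; algebras and tensor products are over $\mathbb{K}$. Algebras are unital and associative and morphisms preserve units. $\mathbf{A}_{\mathrm{c}}$ is the category of commutative algebras, $\mathbf{A}_{\mathrm{cfg}}$ that of commutative finitely generated algebras. $\mathbf{H}$ is the category of Hopf algebras; $\mathbf{H}_{\mathrm{fd}}$ and $\mathbf{H}_{\mathrm{fg}}$ are the full subcategories of finite dimensional ones, respectively of those finitely generated as algebras. For a category $\mathbf{C}$, $\mathbf{proC}$ is the category of pro-objects (inverse systems $\{C_i\}_{i\in\mathbf{I}}$ in $\mathbf{C}$ indexed by directed sets) with $\mathbf{proC}(C,D)=\varprojlim_j\varinjlim_i\mathbf{C}(C_i,D_j)$; objects of $\mathbf{C}$ are regarded as pro-objects over a one-element index set. For pro-algebras $A=\{A_i\}_{i\in\mathbf{I}}$, $B=\{B_j\}_{j\in\mathbf{J}}$, $A\otimes B$ is the pro-algebra indexed by $\mathbf{I}\times\mathbf{J}$ with $(A\otimes B)_{(i,j)}=A_i\otimes B_j$ and the evident transition maps. A commutative pro-algebra is a pro-object of $\mathbf{A}_{\mathrm{c}}$. For Hopf algebras $H_1,H_2$ with comultiplications $\Delta_1,\Delta_2$, a (pro-)family of Hopf-algebra morphisms from $H_1$ to $H_2$ is a pair $(R,\psi)$ where $R$ is a commutative (pro-)algebra and $\psi:H_1\to H_2\otimes R$ is a (pro-)algebra morphism satisfying $$(\Delta_2\otimes\mathrm{id}_R)\psi=(\mathrm{id}_{H_2\otimes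 H_2}\otimes\mu_R)(\mathrm{id}_{H_2}\otimes F\otimes\mathrm{id}_R)(\psi\otimes\psi)\Delta_1,$$ where $\mu_R:R\otimes R\to R$ is the multiplication of $R$ (a (pro-)algebra morphism since $R$ is commutative) and $F:R\otimes H_2\to H_2\otimes R$ is the flip. *)

(* Defs.v *)
From HB Require Import structures.
From mathcomp Require Import all_boot all_order all_algebra.
From mathcomp Require Import boolp.

Set Implicit Arguments.
Unset Strict Implicit.
Unset Printing Implicit Defensive.

Import GRing.Theory.
Local Open Scope ring_scope.

(* [algType] requires [1 != 0]; [algebra] is the same structure without this
   requirement, so that the zero algebra is included. *)
Record algebra (K : fieldType) := Algebra {
  alg_ring : pzRingType;
  alg_lmod : GRing.Nmodule_isLSemiModule K alg_ring;
  alg_scaleAl : forall (a : K) (u v : alg_ring),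
    GRing.Nmodule_isLSemiModule.scale alg_lmod a (u * v)
    = GRing.Nmodule_isLSemiModule.scale alg_lmod a u * v;
  alg_scaleAr : forall (a : K) (u v : alg_ring),
    GRing.Nmodule_isLSemiModule.scale alg_lmod a (u * v)
    = u * GRing.Nmodule_isLSemiModule.scale alg_lmod a v
}.
Definition alg_sort (K : fieldType) (A : algebra K) : Type := alg_ring A.
Coercion alg_sort : algebra >-> Sortclass.
HB.instance Definition _ (K : fieldType) (A : algebra K) :=
  GRing.PzRing.on (alg_sort A).
HB.instance Definition _ (K : fieldType) (A : algebra K) :
  GRing.Nmodule_isLSemiModule K (alg_sort A) := alg_lmod A.
Definition alg_lmodType (K : fieldType) (A : algebra K) : lmodType K := alg_sort A.
Coercion alg_lmodType : algebra >-> GRing.Lmodule.type.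

Section AlgebraTheory.
Variables (K : fieldType).

Lemma algscaleAl (A : algebra K) (a : K) (u v : A) : a *: (u * v) = (a *: u) * v.
Proof. exact: alg_scaleAl. Qed.
Lemma algscaleAr (A : algebra K) (a : K) (u v : A) : a *: (u * v) = u * (a *: v).
Proof. exact: alg_scaleAr. Qed.

Definition algebra_of (A : algType K) : algebra K :=
  @Algebra K A (GRing.Lmodule.class A) (@scalerAl K A) (@scalerAr K A).
End AlgebraTheory.

Record algHom (K : fieldType) (A B : algebra K) := AlgHom {
  algHom_linear :> {linear A -> B};
  algHom_monoid : monoid_morphism algHom_linear
}.

Section AlgHomTheory.
Variable K : fieldType.
Implicit Types A B C : algebra K.

Lemma algHom1 A B (f : algHom A B) : f 1 = 1.
Proof. by case: f => f [f1 fM]. Qed.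
Lemma algHomM A B (f : algHom A B) : {morph f : x y / x * y}.
Proof. by case: f => f [f1 fM]. Qed.

Lemma linear_funP (U V : lmodType K) (f g : {linear U -> V}) : f =1 g -> f = g.
Proof.
case: f => f [[f0] [f1]]; case: g => g [[g0] [g1]] /= /funext fg.
by subst g; rewrite (Prop_irrelevance f0 g0) (Prop_irrelevance f1 g1).
Qed.

Lemma algHomP A B (f g : algHom A B) : f =1 g -> f = g.
Proof.
case: f => f Hf; case: g => g Hg /= /linear_funP fg.
by subst g; rewrite (Prop_irrelevance Hf Hg).
Qed.

Definition algHom_id A : algHom A A.
Proof. by exists (idfun : {linear A -> A}). Defined.

Definition algHom_comp A B C (g : algHom B C) (f : algHom A B) : algHom A C.
Proof.
exists (g \o f : {linear A -> C}).
by split=> [|x y] /=; rewrite ?algHom1 ?algHomM.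
Defined.
End AlgHomTheory.

Section Tensor.
Variables (K : fieldType) (U V : lmodType K).

(* The value of a bilinear map on a formal sum of pure tensors, encoded as a
   sequence of pairs. *)
Definition tsum (W : lmodType K) (f : U -> V -> W) (s : seq (U * V)) : W :=
  \sum_(p <- s) f p.1 p.2.

(* Two formal sums define the same tensor when no bilinear map separates them;
   [tensor_universal] below is the universal property. *)
Definition teqv (s t : seq (U * V)) : bool :=
  `[< forall (W : lmodType K) (f : U -> V -> W),
        bilinear_for *:%R *:%R f -> tsum f s = tsum f t >].

Lemma teqvP s t : reflect (forall (W : lmodType K) (f : U -> V -> W),
  bilinear_for *:%R *:%R f -> tsum f s = tsum f t) (teqv s t).
Proof. exact: asboolP. Qed.

Lemma teqv_refl : reflexive teqv.
Proof. by move=> s; apply/teqvP. Qed.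
Lemma teqv_sym : symmetric teqv.
Proof.
by move=> s t; apply/teqvP/teqvP => st W f bf; rewrite (st W f bf).
Qed.
Lemma teqv_trans : transitive teqv.
Proof.
move=> t s r /teqvP st /teqvP tr; apply/teqvP => W f bf.
by rewrite (st W f bf) (tr W f bf).
Qed.
Canonical teqv_equiv := EquivRel teqv teqv_refl teqv_sym teqv_trans.

Definition tensor : Type := {eq_quot teqv}%qT.
HB.instance Definition _ := Choice.on tensor.
HB.instance Definition _ := EqQuotient.on tensor.

Local Notation tpi := (\pi_tensor)%qT.
Local Notation bilin f := (bilinear_for *:%R *:%R f).

Lemma tpiP s t : teqv s t -> tpi s = tpi t.
Proof. by move=> st; apply/eqmodP. Qed.
Lemma teqv_repr s : teqv (repr (tpi s)) s.
Proof. by apply/eqmodP; rewrite reprK. Qed.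

Lemma tsum_cat (W : lmodType K) (f : U -> V -> W) s t :
  tsum f (s ++ t) = tsum f s + tsum f t.
Proof. exact: big_cat. Qed.
Lemma tsum_scale (W : lmodType K) (f : U -> V -> W) (c : K) s :
  bilin f -> tsum f [seq (c *: p.1, p.2) | p <- s] = c *: tsum f s.
Proof.
move=> bf; rewrite /tsum big_map scaler_sumr; apply: eq_bigr => p _ /=.
exact: (scalable_linear (bf.1 p.2)).
Qed.

Definition tadd (x y : tensor) : tensor := tpi (repr x ++ repr y).
Definition tzero : tensor := tpi [::].
Definition tscale (c : K) (x : tensor) : tensor :=
  tpi [seq (c *: p.1, p.2) | p <- repr x].
Definition topp (x : tensor) : tensor := tscale (-1) x.

Definition tlift (W : lmodType K) (f : U -> V -> W) (x : tensor) : W :=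
  tsum f (repr x).

Lemma tlift_pi (W : lmodType K) (f : U -> V -> W) s :
  bilin f -> tlift f (tpi s) = tsum f s.
Proof. by move=> bf; move/teqvP: (teqv_repr s); apply. Qed.
Lemma tensor_eq (x y : tensor) :
  (forall (W : lmodType K) (f : U -> V -> W), bilin f -> tlift f x = tlift f y) ->
  x = y.
Proof. by move=> xy; rewrite -[x]reprK -[y]reprK; apply/tpiP/teqvP. Qed.

Lemma tlift_add (W : lmodType K) (f : U -> V -> W) x y :
  bilin f -> tlift f (tadd x y) = tlift f x + tlift f y.
Proof. by move=> bf; rewrite tlift_pi // tsum_cat. Qed.
Lemma tlift_zero (W : lmodType K) (f : U -> V -> W) :
  bilin f -> tlift f tzero = 0.
Proof. by move=> bf; rewrite tlift_pi // /tsum big_nil. Qed.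
Lemma tlift_scale (W : lmodType K) (f : U -> V -> W) c x :
  bilin f -> tlift f (tscale c x) = c *: tlift f x.
Proof. by move=> bf; rewrite tlift_pi // tsum_scale. Qed.
Definition tliftE := (tlift_add, tlift_zero, tlift_scale).

Fact taddA : associative tadd.
Proof. by move=> x y z; apply: tensor_eq => W f bf; rewrite !tliftE // addrA. Qed.
Fact taddC : commutative tadd.
Proof. by move=> x y; apply: tensor_eq => W f bf; rewrite !tliftE // addrC. Qed.
Fact tadd0 : left_id tzero tadd.
Proof. by move=> x; apply: tensor_eq => W f bf; rewrite !tliftE // add0r. Qed.
Fact taddN : left_inverse tzero topp tadd.
Proof.
by move=> x; apply: tensor_eq => W f bf; rewrite !tliftE // scaleN1r addNr.
Qed.
HB.instance Definition _ := GRing.isZmodule.Build tensor taddA taddC tadd0 taddN.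

Fact tscaleA a b x : tscale a (tscale b x) = tscale (a * b) x.
Proof. by apply: tensor_eq => W f bf; rewrite !tliftE // scalerA. Qed.
Fact tscale1 : left_id 1 tscale.
Proof. by move=> x; apply: tensor_eq => W f bf; rewrite !tliftE // scale1r. Qed.
Fact tscaleDr : right_distributive tscale +%R.
Proof.
by move=> a x y; apply: tensor_eq => W f bf; rewrite !tliftE // scalerDr.
Qed.
Fact tscaleDl x : {morph tscale^~ x : a b / a + b}.
Proof.
by move=> a b; apply: tensor_eq => W f bf; rewrite !tliftE // scalerDl.
Qed.
HB.instance Definition _ :=
  GRing.Zmodule_isLmodule.Build K tensor tscaleA tscale1 tscaleDr tscaleDl.

Definition ptensor (u : U) (v : V) : tensor := tpi [:: (u, v)].

Lemma tlift_ptensor (W : lmodType K) (f : U -> V -> W) u v :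
  bilin f -> tlift f (ptensor u v) = f u v.
Proof. by move=> bf; rewrite tlift_pi // /tsum big_seq1. Qed.

Lemma tlift_linear (W : lmodType K) (f : U -> V -> W) :
  bilin f -> linear (tlift f).
Proof.
move=> bf a x y; change (tlift f (tadd (tscale a x) y) = a *: tlift f x + tlift f y).
by rewrite !tliftE.
Qed.

Lemma bilinear_ptensor : bilin ptensor.
Proof.
split=> [v a u u' | u a v v']; apply: tensor_eq => W f bf;
  rewrite (tlift_linear bf) !tlift_ptensor //.
  exact: (bf.1 v).
exact: (bf.2 u).
Qed.

Lemma tpi_sum s : tpi s = \sum_(p <- s) ptensor p.1 p.2.
Proof.
elim: s => [|[u v] s IH]; first by rewrite big_nil.
rewrite big_cons -IH.
change (tpi ((u, v) :: s) = tadd (ptensor u v) (tpi s)).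
apply: tensor_eq => W f bf.
by rewrite tlift_add // tlift_ptensor // !tlift_pi // /tsum big_cons.
Qed.

Lemma tensor_sum (x : tensor) : x = \sum_(p <- repr x) ptensor p.1 p.2.
Proof. by rewrite -tpi_sum reprK. Qed.

Lemma tensor_ext (W : lmodType K) (f g : {linear tensor -> W}) :
  (forall u v, f (ptensor u v) = g (ptensor u v)) -> f =1 g.
Proof.
move=> fg x; rewrite [x]tensor_sum !linear_sum.
by apply: eq_bigr => p _; apply: fg.
Qed.
End Tensor.

Local Notation bilin f := (bilinear_for *:%R *:%R f).

Definition linear_of (K : fieldType) (U V : lmodType K) (f : U -> V)
    (lf : linear f) : {linear U -> V} :=
  HB.pack f (GRing.isLinear.Build K U V *:%R f lf).

Theorem tensor_universal (K : fieldType) (U V W : lmodType K) (f : U -> V -> W) :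
  bilin f ->
  exists! g : {linear tensor U V -> W}, forall u v, g (ptensor u v) = f u v.
Proof.
move=> bf; exists (linear_of (tlift_linear bf)); split=> [u v | g gf].
  exact: tlift_ptensor.
apply/linear_funP/tensor_ext => u v; rewrite gf; exact: tlift_ptensor.
Qed.

Section TensorMaps.
Variable K : fieldType.
Implicit Types U V W X : lmodType K.

Lemma bilinear_tlift U V U' V' W (F : U -> V -> U' -> V' -> W) :
  (forall u' v', bilin (fun u v => F u v u' v')) ->
  forall y, bilin (fun u v => tlift (F u v) y).
Proof.
move=> bF y; split=> [v a u1 u2 | u a v1 v2]; rewrite /tlift /tsum /= scaler_sumr -big_split;
  apply: eq_bigr => p _; first exact: ((bF _ _).1 v).
exact: ((bF _ _).2 u).
Qed.

Definition tlift2 U V U' V' W (F : U -> V -> U' -> V' -> W)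
    (x : tensor U V) (y : tensor U' V') : W :=
  tlift (fun u v => tlift (F u v) y) x.

Section Tlift2.
Variables (U V U' V' W : lmodType K) (F : U -> V -> U' -> V' -> W).
Hypothesis bl : forall u' v', bilin (fun u v => F u v u' v').
Hypothesis br : forall u v, bilin (F u v).

Lemma tlift2_ptensor u v u' v' :
  tlift2 F (ptensor u v) (ptensor u' v') = F u v u' v'.
Proof. by rewrite /tlift2 tlift_ptensor ?tlift_ptensor //; apply: bilinear_tlift. Qed.

Lemma bilinear_tlift2 : bilin (tlift2 F).
Proof.
split=> [y | x a y1 y2]; first exact/tlift_linear/bilinear_tlift.
rewrite /tlift2 [tlift _ x]/tlift [in X in _ = _ *: X + _]/tlift.
rewrite [in X in _ = _ + X]/tlift /tsum scaler_sumr -big_split.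
by apply: eq_bigr => p _ /=; apply: (tlift_linear (br _ _)).
Qed.
End Tlift2.

Lemma bilinear_ptensor2 U V U' V' (f : {linear U -> U'}) (g : {linear V -> V'}) :
  bilin (fun u v => ptensor (f u) (g v)).
Proof.
split=> [v a u1 u2 | u a v1 v2]; rewrite linearP.
  exact: ((bilinear_ptensor _ _).1 (g v)).
exact: ((bilinear_ptensor _ _).2 (f u)).
Qed.

Definition tmap U V U' V' (f : {linear U -> U'}) (g : {linear V -> V'}) :
    {linear tensor U V -> tensor U' V'} :=
  linear_of (tlift_linear (bilinear_ptensor2 f g)).

Lemma tmapE U V U' V' (f : {linear U -> U'}) (g : {linear V -> V'}) u v :
  tmap f g (ptensor u v) = ptensor (f u) (g v).
Proof. exact: (tlift_ptensor _ _ (bilinear_ptensor2 f g)). Qed.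
End TensorMaps.
Section TensorStructure.
Variable K : fieldType.

Section Lmodules.
Variables U V W X : lmodType K.

Definition ptensor_l (v : V) : {linear U -> tensor U V} :=
  linear_of ((bilinear_ptensor U V).1 v).
Definition ptensor_r (u : U) : {linear V -> tensor U V} :=
  linear_of ((bilinear_ptensor U V).2 u).

Lemma tensor_ind (P : tensor U V -> Prop) :
  P 0 -> (forall x y, P x -> P y -> P (x + y)) ->
  (forall u v, P (ptensor u v)) -> forall x, P x.
Proof.
move=> P0 PD Pp x; rewrite [x]tensor_sum.
by apply: big_ind => // p _; apply: Pp.
Qed.
End Lmodules.

Lemma ptensor0l (U V : lmodType K) (v : V) : ptensor (0 : U) v = 0.
Proof. exact: (linear0 (ptensor_l U v)). Qed.
Lemma ptensor0r (U V : lmodType K) (u : U) : ptensor u (0 : V) = 0.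
Proof. exact: (linear0 (ptensor_r V u)). Qed.
Lemma ptensorDl (U V : lmodType K) (u u' : U) (v : V) :
  ptensor (u + u') v = ptensor u v + ptensor u' v.
Proof. exact: (linearD (ptensor_l U v)). Qed.
Lemma ptensorDr (U V : lmodType K) (u : U) (v v' : V) :
  ptensor u (v + v') = ptensor u v + ptensor u v'.
Proof. exact: (linearD (ptensor_r V u)). Qed.

Lemma bilinear_tassoc (U V W : lmodType K) :
  bilin (fun (x : tensor U V) (w : W) =>
           tlift (fun u v => ptensor u (ptensor v w)) x).
Proof.
have b w : bilin (fun (u : U) (v : V) => ptensor u (ptensor v w)).
  exact: (bilinear_ptensor2 idfun (ptensor_l V w)).
split=> [w | x a w1 w2]; first exact: tlift_linear.
rewrite /tlift /tsum /= scaler_sumr -big_split; apply: eq_bigr => p _ /=.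
by rewrite (bilinear_ptensor _ _).2 (bilinear_ptensor _ _).2.
Qed.

Definition tassoc (U V W : lmodType K) :
    {linear tensor (tensor U V) W -> tensor U (tensor V W)} :=
  linear_of (tlift_linear (bilinear_tassoc U V W)).

Lemma tassocE (U V W : lmodType K) (u : U) (v : V) (w : W) :
  tassoc U V W (ptensor (ptensor u v) w) = ptensor u (ptensor v w).
Proof.
rewrite [LHS](tlift_ptensor _ _ (bilinear_tassoc U V W)) tlift_ptensor //.
exact: (bilinear_ptensor2 idfun (ptensor_l V w)).
Qed.

Lemma bilinear_scale (U : lmodType K) : bilin (fun (a : K^o) (u : U) => a *: u).
Proof.
split=> [u a b c | a b u v] /=; first by rewrite scalerDl scalerA.
by rewrite scalerDr !scalerA mulrC.
Qed.

Definition tunitl (U : lmodType K) : {linear tensor K^o U -> U} :=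
  linear_of (tlift_linear (bilinear_scale U)).
Lemma bilinear_scale_r (U : lmodType K) : bilin (fun (u : U) (a : K^o) => a *: u).
Proof.
have [bl br] := bilinear_scale U; split=> [a | u]; first exact: br.
exact: bl.
Qed.
Definition tunitr (U : lmodType K) : {linear tensor U K^o -> U} :=
  linear_of (tlift_linear (bilinear_scale_r U)).

Section Interchange.
Variables U V U' V' : lmodType K.
Let F (u : U) (v : V) (u' : U') (v' : V') := ptensor (ptensor u u') (ptensor v v').
Let bl u' v' : bilin (fun u v => F u v u' v').
Proof. exact: (bilinear_ptensor2 (ptensor_l U u') (ptensor_l V v')). Qed.
Let br u v : bilin (F u v).
Proof. exact: (bilinear_ptensor2 (ptensor_r U' u) (ptensor_r V' v)). Qed.

(* [id (x) F (x) id], with [F : V (x) U' -> U' (x) V] the flip, including the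
   reassociations before and after it:
   [(u (x) v) (x) (u' (x) v') |-> (u (x) u') (x) (v (x) v')]. *)
Definition tinterchange :
    {linear tensor (tensor U V) (tensor U' V') -> tensor (tensor U U') (tensor V V')} :=
  linear_of (tlift_linear (bilinear_tlift2 bl br)).

Lemma tinterchangeE u v u' v' :
  tinterchange (ptensor (ptensor u v) (ptensor u' v'))
  = ptensor (ptensor u u') (ptensor v v').
Proof.
by rewrite [LHS](tlift_ptensor _ _ (bilinear_tlift2 bl br)) tlift2_ptensor.
Qed.
End Interchange.
End TensorStructure.
Section TensorAlgebra.
Variable K : fieldType.

Section Mul.
Variable A : algebra K.

Lemma bilinear_mul : bilin (fun a b : A => a * b).
Proof.
split=> [b c x y | a c x y] /=; first by rewrite mulrDl algscaleAl.
by rewrite mulrDr algscaleAr.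
Qed.

Definition mul_map : {linear tensor A A -> A} :=
  linear_of (tlift_linear bilinear_mul).
Lemma mul_mapE (a b : A) : mul_map (ptensor a b) = a * b.
Proof. exact: (tlift_ptensor _ _ bilinear_mul). Qed.
End Mul.

Variables A B : algebra K.
Implicit Types x y z : tensor A B.

(* [(a (x) b) * (a' (x) b') = (a * a') (x) (b * b')] *)
Definition tmul x y : tensor A B :=
  tmap (mul_map A) (mul_map B) (tinterchange A B A B (ptensor x y)).
Definition tone : tensor A B := ptensor (1 : A) (1 : B).

Lemma tmulE (a a' : A) (b b' : B) :
  tmul (ptensor a b) (ptensor a' b') = ptensor (a * a') (b * b').
Proof. by rewrite /tmul tinterchangeE tmapE !mul_mapE. Qed.

Lemma bilinear_tmul : bilin tmul.
Proof.
split=> [z c x y | x c y z] /=; rewrite /tmul.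
  by rewrite (bilinear_ptensor _ _).1 !linearP.
by rewrite (bilinear_ptensor _ _).2 !linearP.
Qed.

Fact tmulDl : left_distributive tmul +%R.
Proof. by move=> x y z; move: (bilinear_tmul.1 z 1 x y); rewrite /= !scale1r. Qed.
Fact tmulDr : right_distributive tmul +%R.
Proof. by move=> x y z; move: (bilinear_tmul.2 x 1 y z); rewrite /= !scale1r. Qed.
Fact tmul0l x : tmul 0 x = 0.
Proof. by apply: (addrI (tmul 0 x)); rewrite -tmulDl !addr0. Qed.
Fact tmul0r x : tmul x 0 = 0.
Proof. by apply: (addrI (tmul x 0)); rewrite -tmulDr !addr0. Qed.
Fact tmulA : associative tmul.
Proof.
move=> x y z; elim/tensor_ind: x => [|x1 x2 IH1 IH2|a b].
- by rewrite !tmul0l.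
- by rewrite !tmulDl IH1 IH2.
elim/tensor_ind: y => [|x1 x2 IH1 IH2|a' b'].
- by rewrite !(tmul0l, tmul0r).
- by rewrite !(tmulDl, tmulDr) IH1 IH2.
elim/tensor_ind: z => [|x1 x2 IH1 IH2|a'' b''].
- by rewrite !tmul0r.
- by rewrite !tmulDr IH1 IH2.
by rewrite !tmulE !mulrA.
Qed.
Fact tmul1l : left_id tone tmul.
Proof.
move=> x; elim/tensor_ind: x => [|x1 x2 IH1 IH2|a b].
- exact: tmul0r.
- by rewrite tmulDr IH1 IH2.
by rewrite tmulE !mul1r.
Qed.
Fact tmul1r : right_id tone tmul.
Proof.
move=> x; elim/tensor_ind: x => [|x1 x2 IH1 IH2|a b].
- exact: tmul0l.
- by rewrite tmulDl IH1 IH2.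
by rewrite tmulE !mulr1.
Qed.
HB.instance Definition _ := GRing.Zmodule_isPzRing.Build (tensor A B)
  tmulA tmul1l tmul1r tmulDl tmulDr.

Fact tscaleAl (c : K) x y : c *: (x * y) = (c *: x) * y.
Proof. by have := bilinear_tmul.1 y c x 0; rewrite tmul0l !addr0. Qed.
Fact tscaleAr (c : K) x y : c *: (x * y) = x * (c *: y).
Proof. by have := bilinear_tmul.2 x c y 0; rewrite tmul0r !addr0. Qed.

Definition tensor_alg : algebra K :=
  @Algebra K (tensor A B) (GRing.Lmodule.class (tensor A B)) tscaleAl tscaleAr.
End TensorAlgebra.

Section TensorAlgHom.
Variable K : fieldType.
Implicit Types A B C D : algebra K.

Lemma tensor_algHom A B C (f : {linear tensor A B -> C}) :
  f (ptensor (1 : A) (1 : B)) = 1 ->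
  (forall (a : A) (b : B) (a' : A) (b' : B), f (ptensor (a * a') (b * b'))
                     = f (ptensor a b) * f (ptensor a' b')) ->
  @monoid_morphism (tensor_alg A B) C f.
Proof.
move=> f1 fM; split=> // x y; change (f (tmul x y) = f x * f y).
elim/tensor_ind: x => [|x1 x2 IH1 IH2|a b].
- by rewrite tmul0l linear0 mul0r.
- by rewrite tmulDl !linearD mulrDl IH1 IH2.
elim/tensor_ind: y => [|x1 x2 IH1 IH2|a' b'].
- by rewrite tmul0r linear0 mulr0.
- by rewrite tmulDr !linearD mulrDr IH1 IH2.
by rewrite tmulE fM.
Qed.

Lemma tensor_algHomP A B C (f g : algHom (tensor_alg A B) C) :
  (forall a b, f (ptensor a b) = g (ptensor a b)) -> f = g.
Proof.
move=> fg; apply: algHomP.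
exact: (@tensor_ext K A B C (algHom_linear f) (algHom_linear g)).
Qed.

Lemma tmap_monoid A A' B B' (f : algHom A A') (g : algHom B B') :
  @monoid_morphism (tensor_alg A B) (tensor_alg A' B') (tmap f g).
Proof.
apply: tensor_algHom => [|a b a' b']; first by rewrite tmapE !algHom1.
by rewrite !tmapE !algHomM -tmulE.
Qed.
Definition tmap_alg A A' B B' (f : algHom A A') (g : algHom B B') :
    algHom (tensor_alg A B) (tensor_alg A' B') :=
  AlgHom (tmap_monoid f g).

Lemma tmap_algE A A' B B' (f : algHom A A') (g : algHom B B') (a : A) (b : B) :
  tmap_alg f g (ptensor a b) = ptensor (f a) (g b).
Proof. exact: tmapE. Qed.

Lemma tmap_alg_id A B :
  tmap_alg (algHom_id A) (algHom_id B) = algHom_id (tensor_alg A B).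
Proof. by apply: tensor_algHomP => a b; rewrite tmap_algE. Qed.

Lemma tmap_alg_comp A A' A'' B B' B''
    (f' : algHom A' A'') (f : algHom A A') (g' : algHom B' B'') (g : algHom B B') :
  algHom_comp (tmap_alg f' g') (tmap_alg f g)
  = tmap_alg (algHom_comp f' f) (algHom_comp g' g).
Proof.
apply: tensor_algHomP => a b.
rewrite tmap_algE; change (tmap f' g' (tmap f g (ptensor a b)) = ptensor (f' (f a)) (g' (g b))).
by rewrite !tmapE.
Qed.

Lemma tinterchange_monoid A B C D :
  @monoid_morphism (tensor_alg (tensor_alg A B) (tensor_alg C D))
    (tensor_alg (tensor_alg A C) (tensor_alg B D)) (tinterchange A B C D).
Proof.
apply: tensor_algHom; first exact: tinterchangeE.
move=> p q p' q'.
elim/tensor_ind: p => [|p1 p2 IH1 IH2|a b].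
- by rewrite mul0r !ptensor0l !linear0 mul0r.
- by rewrite mulrDl !ptensorDl !linearD mulrDl IH1 IH2.
elim/tensor_ind: q => [|q1 q2 IH1 IH2|c d].
- by rewrite mul0r !ptensor0r !linear0 mul0r.
- by rewrite mulrDl !ptensorDr !linearD mulrDl IH1 IH2.
elim/tensor_ind: p' => [|p1 p2 IH1 IH2|a' b'].
- by rewrite mulr0 !ptensor0l !linear0 mulr0.
- by rewrite mulrDr !ptensorDl !linearD mulrDr IH1 IH2.
elim/tensor_ind: q' => [|q1 q2 IH1 IH2|c' d'].
- by rewrite mulr0 !ptensor0r !linear0 mulr0.
- by rewrite mulrDr !ptensorDr !linearD mulrDr IH1 IH2.
rewrite -[ptensor a b * _]/(tmul (ptensor a b) (ptensor a' b')).
rewrite -[ptensor c d * _]/(tmul (ptensor c d) (ptensor c' d')).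
rewrite !tmulE !tinterchangeE.
transitivity (tmul (ptensor (ptensor a c : tensor_alg A C) (ptensor b d : tensor_alg B D))
                   (ptensor (ptensor a' c' : tensor_alg A C) (ptensor b' d' : tensor_alg B D))) => //.
rewrite tmulE; congr ptensor; rewrite -tmulE; reflexivity.
Qed.
Definition tinterchange_alg A B C D :
    algHom (tensor_alg (tensor_alg A B) (tensor_alg C D))
           (tensor_alg (tensor_alg A C) (tensor_alg B D)) :=
  AlgHom (tinterchange_monoid A B C D).

Lemma tinterchange_natural A A' B B' C C' D D' (f : algHom A A') (g : algHom B B')
    (h : algHom C C') (k : algHom D D') :
  algHom_comp (tmap_alg (tmap_alg f h) (tmap_alg g k)) (tinterchange_alg A B C D)
  = algHom_comp (tinterchange_alg A' B' C' D') (tmap_alg (tmap_alg f g) (tmap_alg h k)).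
Proof.
apply: tensor_algHomP => p q.
change (tmap (tmap f h) (tmap g k) (tinterchange A B C D (ptensor p q))
  = tinterchange A' B' C' D' (tmap (tmap f g) (tmap h k) (ptensor p q))).
elim/tensor_ind: p => [|p1 p2 IH1 IH2|a b].
- by rewrite !ptensor0l !linear0.
- by rewrite !ptensorDl !linearD IH1 IH2.
elim/tensor_ind: q => [|q1 q2 IH1 IH2|c d].
- by rewrite !ptensor0r !linear0.
- by rewrite !ptensorDr !linearD IH1 IH2.
by rewrite tinterchangeE !tmapE tinterchangeE.
Qed.

Lemma mul_map_natural A B (f : algHom A B) x :
  f (mul_map A x) = mul_map B (tmap f f x).
Proof.
elim/tensor_ind: x => [|p1 p2 IH1 IH2|a b].
- by rewrite !linear0.
- by rewrite !linearD IH1 IH2.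
by rewrite tmapE !mul_mapE algHomM.
Qed.

Lemma mul_map_monoid A : commutative (fun a b : A => a * b) ->
  @monoid_morphism (tensor_alg A A) A (mul_map A).
Proof.
move=> comA; apply: tensor_algHom => [|a b a' b']; first by rewrite mul_mapE mulr1.
rewrite !mul_mapE -!mulrA; congr (_ * _).
by rewrite !mulrA; congr (_ * _); apply: comA.
Qed.
Definition mul_alg A (comA : commutative (fun a b : A => a * b)) :
    algHom (tensor_alg A A) A :=
  AlgHom (mul_map_monoid comA).
Lemma mul_alg_natural A B comA comB (f : algHom A B) :
  algHom_comp f (@mul_alg A comA) = algHom_comp (@mul_alg B comB) (tmap_alg f f).
Proof. by apply: algHomP => x; apply: mul_map_natural. Qed.
End TensorAlgHom.

Record hopfAlgebra (K : fieldType) := HopfAlgebra {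
  hopf_alg :> algebra K;
  comult : algHom hopf_alg (tensor_alg hopf_alg hopf_alg);
  counit : algHom hopf_alg (algebra_of K^o);
  antipode : {linear hopf_alg -> hopf_alg};
  comultA : forall x,
    tassoc _ _ _ (tmap comult idfun (comult x)) = tmap idfun comult (comult x);
  counitl : forall x, tunitl _ (tmap counit idfun (comult x)) = x;
  counitr : forall x, tunitr _ (tmap idfun counit (comult x)) = x;
  antipodel : forall x,
    mul_map hopf_alg (tmap antipode idfun (comult x)) = (counit x : K) *: (1 : hopf_alg);
  antipoder : forall x,
    mul_map hopf_alg (tmap idfun antipode (comult x)) = (counit x : K) *: (1 : hopf_alg)
}.

(* Such a map automatically commutes with the antipodes. *)
Record hopfHom (K : fieldType) (H H' : hopfAlgebra K) := HopfHom {
  hopfHom_alg :> algHom H H';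
  hopfHom_comult : forall x,
    comult H' (hopfHom_alg x) = tmap hopfHom_alg hopfHom_alg (comult H x);
  hopfHom_counit : forall x, counit H' (hopfHom_alg x) = counit H x
}.

Lemma hopfHomP (K : fieldType) (H H' : hopfAlgebra K) (f g : hopfHom H H') :
  f = g :> algHom H H' -> f = g.
Proof.
case: f => f f1 f2; case: g => g g1 g2 /= fg; subst g.
by rewrite (Prop_irrelevance f1 g1) (Prop_irrelevance f2 g2).
Qed.

Section HopfHomTheory.
Variable K : fieldType.
Implicit Types H : hopfAlgebra K.

Lemma tmap_id (U V : lmodType K) :
  tmap (idfun : {linear U -> U}) (idfun : {linear V -> V}) =1 id.
Proof.
by apply: (@tensor_ext K U V _ _ idfun) => u v; rewrite tmapE.
Qed.

Lemma tmap_comp (U U' U'' V V' V'' : lmodType K)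
    (f' : {linear U' -> U''}) (f : {linear U -> U'})
    (g' : {linear V' -> V''}) (g : {linear V -> V'}) x :
  tmap f' g' (tmap f g x) = tmap (f' \o f) (g' \o g) x.
Proof.
move: x; apply: (@tensor_ext K U V _ (tmap f' g' \o tmap f g)) => u v.
change (tmap f' g' (tmap f g (ptensor u v)) = tmap (f' \o f) (g' \o g) (ptensor u v)).
by rewrite !tmapE.
Qed.

Definition hopfHom_id H : hopfHom H H.
Proof.
exists (algHom_id H) => x //=; rewrite -[LHS]tmap_id.
by congr (tmap _ _ _); apply: linear_funP.
Defined.

Definition hopfHom_comp H H' H'' (g : hopfHom H' H'') (f : hopfHom H H') :
  hopfHom H H''.
Proof.
exists (algHom_comp g f) => x /=.
  rewrite !hopfHom_comult tmap_comp.
  by congr (tmap _ _ _); apply: linear_funP.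
by rewrite !hopfHom_counit.
Defined.
End HopfHomTheory.

Record category := Category {
  obj :> Type;
  mor : obj -> obj -> Type;
  idm : forall a, mor a a;
  mcomp : forall a b c, mor b c -> mor a b -> mor a c;
  comp_idl : forall a b (f : mor a b), mcomp (idm b) f = f;
  comp_idr : forall a b (f : mor a b), mcomp f (idm a) = f;
  compA : forall a b c d (h : mor c d) (g : mor b c) (f : mor a b),
    mcomp h (mcomp g f) = mcomp (mcomp h g) f
}.
Arguments mor {c} a b : rename, simpl never.
Arguments idm {c} a : rename, simpl never.
Arguments mcomp {c} {a b c} g f : rename, simpl never.
Notation "g \oc f" := (mcomp g f) (at level 50, left associativity).

Record functor (C D : category) := Functor {
  fob :> C -> D;
  fmap : forall a b : C, mor a b -> mor (fob a) (fob b);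
  fmap_id : forall a : C, fmap (idm a) = idm (fob a);
  fmap_comp : forall (a b c : C) (g : mor b c) (f : mor a b),
    fmap (g \oc f) = fmap g \oc fmap f
}.
Arguments fmap {C D} F {a b} f : rename.

Definition opcat (C : category) : category :=
  @Category C (fun a b => mor b a) (@idm C) (fun a b c g f => f \oc g)
    (fun a b f => comp_idr f) (fun a b f => comp_idl f)
    (fun a b c d h g f => esym (compA f g h)).

Definition prodcat (C D : category) : category.
Proof.
refine (@Category (C * D) (fun a b => mor a.1 b.1 * mor a.2 b.2)%type
  (fun a => (idm a.1, idm a.2)) (fun a b c g f => (g.1 \oc f.1, g.2 \oc f.2)) _ _ _).
- by move=> a b [f f']; rewrite /= !comp_idl.
- by move=> a b [f f']; rewrite /= !comp_idr.
- by move=> a b c d h g f; rewrite /= !compA.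
Defined.

Record fullobj (C : category) (P : C -> Prop) := FullObj {
  fullval :> C;
  fullvalP : P fullval
}.
Definition fullsub (C : category) (P : C -> Prop) : category :=
  @Category (fullobj P) (fun a b => mor (fullval a) (fullval b))
    (fun a => idm (fullval a)) (fun a b c g f => g \oc f)
    (fun a b f => comp_idl f) (fun a b f => comp_idr f)
    (fun a b c d h g f => compA h g f).
Definition incl (C : category) (P : C -> Prop) : functor (fullsub P) C :=
  @Functor (fullsub P) C (@fullval C P) (fun a b f => f)
    (fun a => erefl) (fun a b c g f => erefl).

Definition Alg (K : fieldType) : category.
Proof.
refine (@Category (algebra K) (@algHom K) (@algHom_id K) (@algHom_comp K) _ _ _).
- by move=> A B f; apply: algHomP.
- by move=> A B f; apply: algHomP.
- by move=> A B C D h g f; apply: algHomP.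
Defined.

Definition HopfAlg (K : fieldType) : category.
Proof.
refine (@Category (hopfAlgebra K) (@hopfHom K) (@hopfHom_id K) (@hopfHom_comp K) _ _ _).
- by move=> A B f; apply/hopfHomP/algHomP.
- by move=> A B f; apply/hopfHomP/algHomP.
- by move=> A B C D h g f; apply/hopfHomP/algHomP.
Defined.

Definition hopf_forget (K : fieldType) : functor (HopfAlg K) (Alg K).
Proof.
refine (@Functor (HopfAlg K) (Alg K) (@hopf_alg K) (fun H H' f => hopfHom_alg f) _ _).
- by [].
- by [].
Defined.

Section Subcategories.
Variable K : fieldType.

Definition alg_commutative (A : algebra K) : Prop := commutative (fun a b : A => a * b).

(* The hypothesis on [S] is [GRing.subalg_closed], which is stated for
   [lalgType] only. *)
Definition alg_fg (A : algebra K) : Prop :=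
  exists s : seq A, forall S : {pred A},
    [/\ 1 \in S, linear_closed S & GRing.mulr_2closed S] ->
    {subset s <= S} -> forall x, x \in S.

Definition alg_fd (A : algebra K) : Prop := exists n, inhabited (Vector.axiom n A).

Definition ComAlg : category := fullsub (alg_commutative : Alg K -> Prop).
Definition CfgAlg : category := fullsub (fun A : ComAlg => alg_fg (fullval A)).
Definition HopfFd : category := fullsub (fun H : HopfAlg K => alg_fd (hopf_alg H)).
Definition HopfFg : category := fullsub (fun H : HopfAlg K => alg_fg (hopf_alg H)).
End Subcategories.

Record directedSet := DirectedSet {
  dir_sort :> Type;
  dir_le : dir_sort -> dir_sort -> Prop;
  dir_refl : forall i, dir_le i i;
  dir_trans : forall i j k, dir_le i j -> dir_le j k -> dir_le i k;
  dir_inhabited : inhabited dir_sort;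
  dir_ub : forall i j, exists2 k, dir_le i k & dir_le j k
}.

Definition dir_unit : directedSet.
Proof.
refine (@DirectedSet unit (fun _ _ => True) _ _ (inhabits tt) _) => //.
Defined.

Definition dir_prod (I J : directedSet) : directedSet.
Proof.
refine (@DirectedSet (I * J) (fun p q => dir_le p.1 q.1 /\ dir_le p.2 q.2) _ _ _ _).
- by move=> p; split; apply: dir_refl.
- by move=> p q r [p1 p2] [q1 q2]; split; [apply: dir_trans q1|apply: dir_trans q2].
- by have [i] := dir_inhabited I; have [j] := dir_inhabited J; exists; exact: (i, j).
- move=> [i j] [i' j']; have [k ik i'k] := dir_ub i i'; have [l jl j'l] := dir_ub j j'.
  by exists (k, l).
Defined.

Definition dir_le1 (I J : directedSet) (p q : dir_prod I J) (h : dir_le p q) :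
  dir_le p.1 q.1 := let: conj h1 _ := h in h1.
Definition dir_le2 (I J : directedSet) (p q : dir_prod I J) (h : dir_le p q) :
  dir_le p.2 q.2 := let: conj _ h2 := h in h2.

Record proObj (C : category) := ProObj {
  pro_idx : directedSet;
  pro_ob :> pro_idx -> C;
  pro_tr : forall i j : pro_idx, dir_le i j -> mor (pro_ob j) (pro_ob i);
  pro_tr_id : forall (i : pro_idx) (h : dir_le i i), pro_tr h = idm (pro_ob i);
  pro_tr_comp : forall (i j k : pro_idx) (hij : dir_le i j) (hjk : dir_le j k)
    (hik : dir_le i k), pro_tr hij \oc pro_tr hjk = pro_tr hik
}.

Section Colim.
Variable C : category.
Implicit Types (X : proObj C) (d e : C).

(* [colim X d] is the colimit over [i] of the sets [mor (X i) d]: its elements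
   are the equivalence classes of pairs [(i, f : mor (X i) d)]. *)
Definition germ X d := {i : pro_idx X & mor (X i) d}.
Definition germ_eq X d (x y : germ X d) : Prop :=
  exists k (hx : dir_le (tag x) k) (hy : dir_le (tag y) k),
    tagged x \oc pro_tr hx = tagged y \oc pro_tr hy.
Definition colim X d := {P : germ X d -> Prop | exists x, P = germ_eq x}.
Definition germ_class X d (x : germ X d) : colim X d :=
  exist _ (germ_eq x) (ex_intro _ x erefl).
Definition germ_repr X d (c : colim X d) : germ X d := sval (cid (svalP c)).

Lemma germ_refl X d (x : germ X d) : germ_eq x x.
Proof. by exists (tag x), (dir_refl _), (dir_refl _). Qed.
Lemma germ_sym X d (x y : germ X d) : germ_eq x y -> germ_eq y x.
Proof. by move=> [k [hx [hy e]]]; exists k, hy, hx. Qed.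
Lemma germ_trans X d (x y z : germ X d) : germ_eq x y -> germ_eq y z -> germ_eq x z.
Proof.
move=> [k [hx [hy e]]] [l [hy' [hz e']]].
have [m km lm] := dir_ub k l.
exists m, (dir_trans hx km), (dir_trans hz lm).
rewrite -(pro_tr_comp hx km) -(pro_tr_comp hz lm) !compA e -e' -!compA.
by rewrite !(pro_tr_comp _ _ (dir_trans hy km)).
Qed.

Lemma germ_reprK X d (c : colim X d) : germ_class (germ_repr c) = c.
Proof.
rewrite /germ_repr; case: cid => x /= Hx; case: c Hx => P HP /= Hx; subst P.
by congr exist; apply: Prop_irrelevance.
Qed.
Lemma germ_classP X d (x y : germ X d) : germ_class x = germ_class y <-> germ_eq x y.
Proof.
split=> [[e] | xy]; first by rewrite e; apply: germ_refl.
have e : germ_eq x = germ_eq y.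
  apply/funext => z; apply/propext; split; apply: germ_trans => //.
  exact: germ_sym.
rewrite /germ_class; move: (ex_intro _ x _) (ex_intro _ y _); rewrite e => p q.
by congr exist; apply: Prop_irrelevance.
Qed.
Lemma germ_class_repr X d (x : germ X d) : germ_eq (germ_repr (germ_class x)) x.
Proof. by apply/germ_classP; rewrite germ_reprK. Qed.

Definition germ_post X d e (u : mor d e) (x : germ X d) : germ X e :=
  Tagged (fun i => mor (X i) e) (u \oc tagged x).
Definition colim_post X d e (u : mor d e) (c : colim X d) : colim X e :=
  germ_class (germ_post u (germ_repr c)).

Lemma germ_post_eq X d e (u : mor d e) (x y : germ X d) :
  germ_eq x y -> germ_eq (germ_post u x) (germ_post u y).
Proof. by move=> [k [hx [hy E]]]; exists k, hx, hy; rewrite /= -!compA E. Qed.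
Lemma colim_post_class X d e (u : mor d e) (x : germ X d) :
  colim_post u (germ_class x) = germ_class (germ_post u x).
Proof. by apply/germ_classP/germ_post_eq/germ_class_repr. Qed.

Lemma colim_ind X d (P : colim X d -> Prop) :
  (forall i (f : mor (X i) d), P (germ_class (Tagged (fun i => mor (X i) d) f))) ->
  forall c, P c.
Proof. by move=> Pc c; rewrite -[c]germ_reprK; case: (germ_repr c) => i f; apply: Pc. Qed.

Lemma colim_post_id X d (c : colim X d) : colim_post (idm d) c = c.
Proof.
elim/colim_ind: c => i f.
by rewrite colim_post_class /germ_post /= comp_idl.
Qed.
Lemma colim_post_comp X d e e' (v : mor e e') (u : mor d e) (c : colim X d) :
  colim_post v (colim_post u c) = colim_post (v \oc u) c.
Proof.
by elim/colim_ind: c => i f; rewrite !colim_post_class /germ_post /= compA.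
Qed.

(* [lim_j colim_i mor (X i) (Y j)] *)
Definition proHom X (Y : proObj C) :=
  {f : forall j : pro_idx Y, colim X (Y j) |
    forall (j j' : pro_idx Y) (h : dir_le j j'), colim_post (pro_tr h) (f j') = f j}.

Lemma proHomP X Y (f g : proHom X Y) : (forall j, sval f j = sval g j) -> f = g.
Proof.
case: f => f Hf; case: g => g Hg /= fg.
have e : f = g by apply: functional_extensionality_dep.
by subst g; congr exist; apply: Prop_irrelevance.
Qed.

(* The morphism represented by [f j : mor (X (phi j)) (Y j)]. *)
Lemma pro_level_compat X Y (phi : pro_idx Y -> pro_idx X)
    (phi_le : forall j j', dir_le j j' -> dir_le (phi j) (phi j'))
    (f : forall j, mor (X (phi j)) (Y j))
    (f_tr : forall j j' (h : dir_le j j'),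
       pro_tr h \oc f j' = f j \oc pro_tr (phi_le j j' h)) :
  forall (j j' : pro_idx Y) (h : dir_le j j'),
    colim_post (pro_tr h) (germ_class (Tagged (fun i => mor (X i) (Y j')) (f j')))
    = germ_class (Tagged (fun i => mor (X i) (Y j)) (f j)).
Proof.
move=> j j' h; rewrite colim_post_class; apply/germ_classP.
exists (phi j'), (dir_refl _), (phi_le _ _ h); rewrite /= f_tr.
by rewrite pro_tr_id comp_idr.
Qed.
Definition pro_level X Y (phi : pro_idx Y -> pro_idx X)
    (phi_le : forall j j', dir_le j j' -> dir_le (phi j) (phi j'))
    (f : forall j, mor (X (phi j)) (Y j))
    (f_tr : forall j j' (h : dir_le j j'),
       pro_tr h \oc f j' = f j \oc pro_tr (phi_le j j' h)) : proHom X Y :=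
  exist _ (fun j => germ_class (Tagged (fun i => mor (X i) (Y j)) (f j)))
    (pro_level_compat f_tr).

Definition pro_id X : proHom X X.
Proof.
refine (@pro_level X X id (fun _ _ h => h) (fun j => idm (X j)) _).
by move=> j j' h; rewrite comp_idl comp_idr.
Defined.

Definition colim_comp X Y d (v : colim Y d) (f : proHom X Y) : colim X d :=
  colim_post (tagged (germ_repr v)) (sval f (tag (germ_repr v))).

Lemma colim_comp_class X Y d (j : pro_idx Y) (v : mor (Y j) d) (f : proHom X Y) :
  colim_comp (germ_class (Tagged (fun j => mor (Y j) d) v)) f
  = colim_post v (sval f j).
Proof.
have [k [h [h' e]]] := germ_class_repr (Tagged (fun j => mor (Y j) d) v).
by rewrite /colim_comp -(svalP f _ _ h) -(svalP f _ _ h') !colim_post_comp e.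
Qed.

Lemma colim_comp_post X Y d e (u : mor d e) (v : colim Y d) (f : proHom X Y) :
  colim_post u (colim_comp v f) = colim_comp (colim_post u v) f.
Proof.
elim/colim_ind: v => j v.
by rewrite colim_post_class !colim_comp_class colim_post_comp.
Qed.

Definition pro_comp X Y Z (g : proHom Y Z) (f : proHom X Y) : proHom X Z.
Proof.
exists (fun k => colim_comp (sval g k) f).
by move=> j j' h; rewrite colim_comp_post (svalP g).
Defined.
End Colim.

Definition Pro (C : category) : category.
Proof.
refine (@Category (proObj C) (@proHom C) (@pro_id C) (@pro_comp C) _ _ _).
- move=> X Y f; apply: proHomP => j /=.
  by rewrite colim_comp_class colim_post_id.
- move=> X Y f; apply: proHomP => j /=.
  by elim/colim_ind: (sval f j) => i u; rewrite colim_comp_class colim_post_class /germ_post /= comp_idr.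
- move=> X Y Z W h g f; apply: proHomP => j /=.
  elim/colim_ind: (sval h j) => i u; rewrite (colim_comp_class u g).
  by etransitivity; [apply: colim_comp_class | apply: colim_comp_post].
Defined.

Definition pro_const_ob (C : category) (c : C) : proObj C.
Proof.
refine (@ProObj C dir_unit (fun _ => c) (fun _ _ _ => idm c) _ _) => //.
by move=> *; rewrite comp_idl.
Defined.
Definition pro_const_map (C : category) (c d : C) (f : mor c d) :
  proHom (pro_const_ob c) (pro_const_ob d).
Proof.
refine (@pro_level C (pro_const_ob c) (pro_const_ob d) id (fun _ _ h => h) (fun _ => f) _).
by move=> *; rewrite /= comp_idl comp_idr.
Defined.
Definition pro_const (C : category) : functor C (Pro C).
Proof.
refine (@Functor C (Pro C) (@pro_const_ob C) (@pro_const_map C) _ _).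
- by move=> c; apply: proHomP.
- move=> a b c g f; apply: proHomP => j /=.
  by rewrite colim_comp_class colim_post_class.
Defined.

Section ProFunctor.
Variables (C D : category) (F : functor C D).

Definition pro_map_ob (X : proObj C) : proObj D.
Proof.
refine (@ProObj D (pro_idx X) (fun i => F (X i)) (fun i j h => fmap F (pro_tr h)) _ _).
- by move=> i h; rewrite pro_tr_id fmap_id.
- by move=> i j k hij hjk hik; rewrite -fmap_comp (pro_tr_comp _ _ hik).
Defined.

Definition germ_map X d (x : germ X d) : germ (pro_map_ob X) (F d) :=
  Tagged (fun i => mor (pro_map_ob X i) (F d)) (fmap F (tagged x)).
Lemma germ_map_eq X d (x y : germ X d) :
  germ_eq x y -> germ_eq (germ_map x) (germ_map y).
Proof. by move=> [k [hx [hy e]]]; exists k, hx, hy; rewrite /= -!fmap_comp e. Qed.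
Definition colim_map X d (c : colim X d) : colim (pro_map_ob X) (F d) :=
  germ_class (germ_map (germ_repr c)).
Lemma colim_map_class X d (x : germ X d) :
  colim_map (germ_class x) = germ_class (germ_map x).
Proof. by apply/germ_classP/germ_map_eq/germ_class_repr. Qed.
Lemma colim_map_post X d e (u : mor d e) (c : colim X d) :
  colim_map (colim_post u c) = colim_post (fmap F u) (colim_map c).
Proof.
elim/colim_ind: c => i f.
rewrite colim_post_class !colim_map_class colim_post_class.
by rewrite /germ_map /germ_post /= fmap_comp.
Qed.

Definition pro_map_hom (X Y : proObj C) (f : proHom X Y) :
  proHom (pro_map_ob X) (pro_map_ob Y).
Proof.
exists (fun j => colim_map (sval f j)).
by move=> j j' h; rewrite /= -colim_map_post (svalP f).
Defined.

Lemma pro_map_id (X : proObj C) : pro_map_hom (pro_id X) = pro_id (pro_map_ob X).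
Proof.
apply: proHomP => j; rewrite [LHS]colim_map_class.
by rewrite /germ_map /= fmap_id.
Qed.

Lemma pro_map_comp (X Y Z : proObj C) (g : proHom Y Z) (f : proHom X Y) :
  pro_map_hom (pro_comp g f) = pro_comp (pro_map_hom g) (pro_map_hom f).
Proof.
apply: proHomP => k; change (colim_map (colim_comp (sval g k) f)
  = colim_comp (colim_map (sval g k)) (pro_map_hom f)).
elim/colim_ind: (sval g k) => j u.
rewrite colim_comp_class colim_map_post colim_map_class.
by rewrite (@colim_comp_class D _ (pro_map_ob Y)).
Qed.

Definition pro_map : functor (Pro C) (Pro D) :=
  @Functor (Pro C) (Pro D) pro_map_ob pro_map_hom pro_map_id pro_map_comp.
End ProFunctor.

Section Families.
Variable K : fieldType.
Implicit Types A B C D : Alg K.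

Definition atensor A B : Alg K := tensor_alg A B.
Definition atmap A A' B B' (f : mor A A') (g : mor B B') :
  mor (atensor A B) (atensor A' B') := tmap_alg f g.
Definition ainterchange A B C D :
  mor (atensor (atensor A B) (atensor C D)) (atensor (atensor A C) (atensor B D)) :=
  tinterchange_alg A B C D.
Definition acomult (H : HopfAlg K) :
  mor (hopf_forget K H) (atensor (hopf_forget K H) (hopf_forget K H)) := comult H.
Definition amul (R : ComAlg K) :
  mor (atensor (incl _ R) (incl _ R)) (incl _ R : Alg K) := mul_alg (fullvalP R).

Lemma atmap_id A B : atmap (idm A) (idm B) = idm (atensor A B).
Proof. exact: tmap_alg_id. Qed.
Lemma atmap_comp A A' A'' B B' B'' (f' : mor A' A'') (f : mor A A')
    (g' : mor B' B'') (g : mor B B') :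
  atmap f' g' \oc atmap f g = atmap (f' \oc f) (g' \oc g).
Proof. exact: tmap_alg_comp. Qed.
Lemma ainterchange_natural A A' B B' C C' D D' (f : mor A A') (g : mor B B')
    (h : mor C C') (k : mor D D') :
  atmap (atmap f h) (atmap g k) \oc ainterchange A B C D
  = ainterchange A' B' C' D' \oc atmap (atmap f g) (atmap h k).
Proof. exact: tinterchange_natural. Qed.
Lemma amul_natural (R S : ComAlg K) (f : mor R S) :
  fmap (incl _) f \oc amul R = amul S \oc atmap (fmap (incl _) f) (fmap (incl _) f).
Proof. exact: mul_alg_natural. Qed.

Definition is_family (H1 H2 : HopfAlg K) (R : ComAlg K)
    (psi : mor (hopf_forget K H1) (atensor (hopf_forget K H2) (incl _ R))) : Prop :=
  atmap (acomult H2) (idm (incl _ R)) \oc psi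
  = atmap (idm (atensor (hopf_forget K H2) (hopf_forget K H2))) (amul R)
    \oc ainterchange (hopf_forget K H2) (incl _ R) (hopf_forget K H2) (incl _ R)
    \oc atmap psi psi \oc acomult H1.
End Families.

Section ProFamilies.
Variable K : fieldType.
Implicit Types X Y Z W : Pro (Alg K).

Definition prtensor_ob X Y : proObj (Alg K).
Proof.
refine (@ProObj (Alg K) (dir_prod (pro_idx X) (pro_idx Y))
  (fun p => atensor (pro_ob p.1) (pro_ob p.2))
  (fun p q h => atmap (pro_tr (dir_le1 h)) (pro_tr (dir_le2 h))) _ _).
- by move=> p h; rewrite !pro_tr_id atmap_id.
- move=> p q r hpq hqr hpr; rewrite atmap_comp.
  rewrite (pro_tr_comp (dir_le1 hpq) (dir_le1 hqr) (dir_le1 hpr)).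
  by rewrite (pro_tr_comp (dir_le2 hpq) (dir_le2 hqr) (dir_le2 hpr)).
Defined.
Definition prtensor X Y : Pro (Alg K) := prtensor_ob X Y.

Definition germ_tensor X Y A B (x : germ X A) (y : germ Y B) :
    germ (prtensor_ob X Y) (atensor A B) :=
  @Tagged (pro_idx (prtensor_ob X Y)) (tag x, tag y) (fun p => mor (prtensor_ob X Y p) (atensor A B))
    (atmap (tagged x) (tagged y)).

Definition colim_tensor X Y A B (x : colim X A) (y : colim Y B) :
    colim (prtensor_ob X Y) (atensor A B) :=
  germ_class (germ_tensor (germ_repr x) (germ_repr y)).

Lemma germ_tensor_eq X Y A B (x x' : germ X A) (y y' : germ Y B) :
  germ_eq x x' -> germ_eq y y' -> germ_eq (germ_tensor x y) (germ_tensor x' y').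
Proof.
move=> [k [h [h' e]]] [l [i [i' e']]]; exists (k, l), (conj h i), (conj h' i').
by rewrite /= !atmap_comp e e'.
Qed.

Lemma colim_tensor_class X Y A B (x : germ X A) (y : germ Y B) :
  colim_tensor (germ_class x) (germ_class y) = germ_class (germ_tensor x y).
Proof. by apply/germ_classP/germ_tensor_eq; apply: germ_class_repr. Qed.

Lemma colim_tensor_post X Y (A B A' B' : Alg K) (u : mor A A') (v : mor B B')
    (x : colim X A) (y : colim Y B) :
  colim_post (atmap u v) (colim_tensor x y)
  = colim_tensor (colim_post u x) (colim_post v y).
Proof.
elim/colim_ind: x => i f; elim/colim_ind: y => j g.
rewrite (colim_post_class u) (colim_post_class v) !colim_tensor_class.
by rewrite colim_post_class /germ_post /germ_tensor /= atmap_comp.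
Qed.

Definition prmap_hom X X' Y Y' (f : proHom X X') (g : proHom Y Y') :
  proHom (prtensor_ob X Y) (prtensor_ob X' Y').
Proof.
exists (fun p => colim_tensor (sval f p.1) (sval g p.2)).
by move=> p q h; rewrite [LHS]colim_tensor_post (svalP f _ _ (dir_le1 h)) (svalP g _ _ (dir_le2 h)).
Defined.
Definition prmap X X' Y Y' (f : mor X X') (g : mor Y Y') :
  mor (prtensor X Y) (prtensor X' Y') := prmap_hom f g.

Lemma prmap_id X Y : prmap (idm X) (idm Y) = idm (prtensor X Y).
Proof.
apply: proHomP => -[i j]; rewrite [LHS]colim_tensor_class.
by rewrite /germ_tensor /= atmap_id.
Qed.
Lemma prmap_comp X X' X'' Y Y' Y'' (f' : mor X' X'') (f : mor X X')
    (g' : mor Y' Y'') (g : mor Y Y') :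
  prmap f' g' \oc prmap f g = prmap (f' \oc f) (g' \oc g).
Proof.
apply: proHomP => p.
change (colim_comp (colim_tensor (sval f' p.1) (sval g' p.2)) (prmap_hom f g)
  = colim_tensor (colim_comp (sval f' p.1) f) (colim_comp (sval g' p.2) g)).
elim/colim_ind: (sval f' p.1) => i u; elim/colim_ind: (sval g' p.2) => j v.
rewrite (colim_comp_class u) (colim_comp_class v) colim_tensor_class.
rewrite -colim_tensor_post.
exact: (@colim_comp_class _ _ (prtensor_ob X' Y') _ (i, j) (atmap u v) (prmap_hom f g)).
Qed.

Definition printerchange X Y Z W :
    mor (prtensor (prtensor X Y) (prtensor Z W)) (prtensor (prtensor X Z) (prtensor Y W)) :=
  @pro_level (Alg K) (prtensor (prtensor X Y) (prtensor Z W))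
    (prtensor (prtensor X Z) (prtensor Y W))
    (fun p => ((p.1.1, p.2.1), (p.1.2, p.2.2)))
    (fun p q h => conj (conj (dir_le1 (dir_le1 h)) (dir_le1 (dir_le2 h)))
                       (conj (dir_le2 (dir_le1 h)) (dir_le2 (dir_le2 h))))
    (fun p => ainterchange (pro_ob p.1.1) (pro_ob p.2.1) (pro_ob p.1.2) (pro_ob p.2.2))
    (fun p q h => ainterchange_natural _ _ _ _).

Definition hopf_pro (H : HopfAlg K) : Pro (Alg K) := pro_const _ (hopf_forget K H).
Lemma prcomult_compat (H : HopfAlg K) :
  atmap (idm _) (idm _) \oc acomult H = acomult H \oc idm (hopf_forget K H).
Proof. by rewrite atmap_id comp_idl comp_idr. Qed.
(* [prtensor (hopf_pro H) (hopf_pro H)] is indexed by [unit * unit], hence is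
   isomorphic, but not equal, to the constant pro-algebra on [H (x) H]. *)
Definition prcomult (H : HopfAlg K) :
    mor (hopf_pro H) (prtensor (hopf_pro H) (hopf_pro H)) :=
  @pro_level (Alg K) (hopf_pro H) (prtensor (hopf_pro H) (hopf_pro H))
    (fun _ => tt) (fun _ _ _ => I) (fun _ => acomult H)
    (fun _ _ _ => prcomult_compat H).

Definition com_pro : functor (Pro (ComAlg K)) (Pro (Alg K)) := pro_map (incl _).
Definition prmul (R : Pro (ComAlg K)) : mor (prtensor (com_pro R) (com_pro R)) (com_pro R) :=
  @pro_level (Alg K) (prtensor (com_pro R) (com_pro R)) (com_pro R)
    (fun j => (j, j)) (fun _ _ h => conj h h) (fun j => amul (@pro_ob _ R j))
    (fun j j' h => amul_natural _).

Definition is_pro_family (H1 H2 : HopfAlg K) (R : Pro (ComAlg K))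
    (psi : mor (hopf_pro H1) (prtensor (hopf_pro H2) (com_pro R))) : Prop :=
  prmap (prcomult H2) (idm (com_pro R)) \oc psi
  = prmap (idm (prtensor (hopf_pro H2) (hopf_pro H2))) (prmul R)
    \oc printerchange (hopf_pro H2) (com_pro R) (hopf_pro H2) (com_pro R)
    \oc prmap psi psi \oc prcomult H1.
End ProFamilies.

(* Main.v *)
Require Import Defs.
From HB Require Import structures.
From mathcomp Require Import all_boot all_order all_algebra.
From mathcomp Require Import boolp classical_sets.

Set Implicit Arguments.
Unset Strict Implicit.
Unset Printing Implicit Defensive.

Import GRing.Theory.
Local Open Scope ring_scope.

(** Call [b : H1 -> seq H2] a bound for a family [psi : H1 -> H2 (x) R] when every
    [psi x] lies in [span (b x) (x) R].  For a fixed bound [b] the families bounded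
    by [b] are represented by a commutative algebra [A_b].  A family is determined by
    its coordinates [(l (x) id) (psi x)], for [x] in [H1] and [l] a linear functional
    on [H2].  So let [A_b] be generated by one symbol for each pair [(x, l)], subject
    to all the relations that hold between the coordinates of every family bounded by
    [b] ([valuation_algebra]).  Each bounded family then induces a morphism out of
    [A_b], and these morphisms are jointly injective on [A_b].  Since functionals
    separate the elements of [U (x) A_b] for any vector space [U] ([contract_eq0]), they stay
    jointly injective after tensoring ([universal_sep]).  Because [b x] is finite, the
    symbols [(x, l)] with [x] fixed assemble into an element of [H2 (x) A_b]: a
    finite sum [sum_k v_k (x) (x, l_k)], where [u |-> sum_k l_k u *: v_k] fixes [b x].
    The map [H1 -> H2 (x) A_b] so obtained specializes to every bounded family, so by
    joint injectivity it inherits all that bounded families share: it is linear,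
    multiplicative, a family, and bounded by [b].

    If [H2] has finite dimension, a basis of [H2] is a bound for all families, and
    [A_b] is the algebra of part (i).  In general every family has some bound, and
    bounds form a directed set, so that the [A_b] form a pro-algebra.  A pro-family
    is a compatible system of ordinary families, one for each index of [R]
    ([is_pro_family_level]); each of them factors through some [A_b], and two
    factorizations agree over a common larger bound ([universal_germ_eq]).  This is
    the universal property of part (ii).  If [H1] is generated by a finite set, the
    symbols [(x, l_k)] with [x] in that set generate [A_b]
    ([universal_alg_fg]): the [x] whose coordinates all lie in a given subalgebra
    form a subalgebra of [H1].

    That the representing objects are functorial and the universal families natural
    is formal ([representing_functor]): families can be composed with Hopf algebra
    morphisms on both sides, and the arrows between representing objects are those
    that classify the composites. *)

(** * Functionals and tensor products *)

Local Notation bilin f := (bilinear_for *:%R *:%R f).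

Section LinearAlgebra.
Variable K : fieldType.
Implicit Types U V W : lmodType K.

Definition subspace U (S : U -> Prop) : Prop :=
  S 0 /\ forall a x y, S x -> S y -> S (a *: x + y).

Lemma subspaceZ U (S : U -> Prop) a x : subspace S -> S x -> S (a *: x).
Proof. by move=> [S0 SP] Sx; rewrite -[_ *: _]addr0; apply: SP. Qed.

Lemma subspaceB U (S : U -> Prop) x y : subspace S -> S x -> S y -> S (x - y).
Proof. by move=> [S0 SP] Sx Sy; rewrite addrC -scaleN1r; apply: SP. Qed.

(** A subspace [M] that contains [S] and is maximal among those avoiding [u] is a
    hyperplane complementary to the line of [u]; [l] is the coordinate along [u]. *)
Lemma separating_functional U (S : U -> Prop) (u : U) :
  subspace S -> ~ S u ->
  exists2 l : {linear U -> K^o}, (forall x, S x -> l x = 0) & l u = 1.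
Proof.
move=> subS nSu.
(* The empty set counts, so that the union of the empty chain qualifies. *)
pose P (M : set U) := (forall x, ~ M x) \/ [/\ subspace M, forall x, S x -> M x & ~ M u].
have [|M [PM maxM]] := @Zorn_bigcup U P.
  move=> F FP Ftot.
  case: (pselect (exists2 M, F M & exists x, M x)) => [[M FM [x Mx]]|noM]; last first.
    by left=> x [M FM Mx]; apply: noM; exists M => //; exists x.
  have good N y : F N -> N y -> [/\ subspace N, forall x, S x -> N x & ~ N u].
    by move=> FN Ny; case: (FP _ FN) => // empN; case: (empN y).
  right; split.
  - split; first by exists M => //; have [[M0 _] _ _] := good _ _ FM Mx.
    move=> a y z [N FN Ny] [N' FN' N'z].
    have [NN'|N'N] := Ftot _ _ FN FN'.
      exists N' => //; have [[_ lin] _ _] := good _ _ FN' N'z.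
      by apply: lin => //; apply: NN'.
    exists N => //; have [[_ lin] _ _] := good _ _ FN Ny.
    by apply: lin => //; apply: N'N.
  - by move=> y Sy; exists M => //; have [_ SM _] := good _ _ FM Mx; apply: SM.
  - by move=> [N FN Nu]; have [_ _] := good _ _ FN Nu.
have [subM SM nMu] : [/\ subspace M, forall x, S x -> M x & ~ M u].
  case: PM => // empM.
  case: (@maxM S); last by right.
  split; first by move=> x /empM.
  by move=> SM; apply: (empM 0); apply: SM; case: subS.
(* If no multiple of [u] brings [x] into [M], then [M + K x] still avoids [u],
   against maximality. *)
have hyper x : exists c : K^o, M (x - c *: u).
  case: (pselect (exists c : K, M (x - c *: u))) => [[c Mc]|noc]; first by exists c.
  pose N : set U := fun y => exists a : K, M (y - a *: x).
  case: (maxM N).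
    split; last first.
      move=> NM; apply: noc; exists 0; rewrite scale0r subr0; apply: NM.
      by exists 1; rewrite scale1r subrr; case: subM.
    by move=> y My; exists 0; rewrite scale0r subr0.
  right; split.
  - split; first by exists 0; rewrite scale0r subr0; case: subM.
    move=> a y z [b Mb] [c Mc]; exists (a * b + c).
    rewrite (_ : _ - _ = a *: (y - b *: x) + (z - c *: x)); first by apply: subM.2.
    by rewrite scalerBr scalerA scalerDl opprD addrACA.
  - by move=> y Sy; exists 0; rewrite scale0r subr0; apply: SM.
  move=> [a Ma]; have [a0|a0] := eqVneq a 0.
    by apply: nMu; move: Ma; rewrite a0 scale0r subr0.
  apply: noc; exists a^-1.
  rewrite (_ : _ - _ = (- a^-1) *: (u - a *: x)); first exact: subspaceZ.
  by rewrite scalerBr scalerA mulNr mulVf // !scaleNr scale1r opprK addrC.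
pose l x : K^o := sval (cid (hyper x)).
have lP x : M (x - l x *: u) by rewrite /l; case: cid.
have l_unique x (c : K) : M (x - c *: u) -> l x = c.
  move=> Mc; apply: contrapT => /eqP; rewrite -subr_eq0 => lc.
  apply: nMu; rewrite -[u]scale1r -(mulVf lc) -scalerA.
  apply: subspaceZ => //.
  rewrite (_ : _ *: u = (x - c *: u) - (x - l x *: u)); first exact: subspaceB.
  by rewrite opprB [RHS]addrC addrA subrK scalerBl.
have l_lin : linear l.
  move=> a x y; apply: l_unique.
  rewrite (_ : _ - _ = a *: (x - l x *: u) + (y - l y *: u)); first exact: subM.2.
  by rewrite scalerBr scalerA scalerDl opprD addrACA.
exists (linear_of l_lin) => [x Sx|]; apply: l_unique.
  by rewrite scale0r subr0; apply: SM.
by rewrite scale1r subrr; case: subM.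
Qed.

Lemma finite_rank_linear U (s : seq ({linear U -> K^o} * U)) :
  linear (fun u => \sum_(p <- s) (p.1 u : K) *: p.2).
Proof.
move=> a x y; rewrite scaler_sumr -big_split.
by apply: eq_bigr => p _; rewrite linearP scalerDl scalerA.
Qed.

Definition finite_rank U (s : seq ({linear U -> K^o} * U)) : {linear U -> U} :=
  linear_of (finite_rank_linear s).

(** A substitute for projecting onto the span of [w]: neither a basis of that span
    nor a complement has to be chosen.  A vector [u] that is not yet fixed by the
    operator is separated from the subspace of its fixed points, and a rank-one
    correction makes [u] fixed too. *)
Lemma finite_rank_identity U (w : seq U) :
  exists s, forall u, u \in w -> finite_rank s u = u.
Proof.
elim: w => [|u w [s sP]]; first by exists [::].
case: (pselect (finite_rank s u = u)) => [su|su].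
  by exists s => v /[!inE] /orP[/eqP->|/sP].
have subS : subspace (fun v => finite_rank s v = v).
  by split=> [|a x y Sx Sy]; rewrite ?linear0 // linearP Sx Sy.
have [l lS lu] := separating_functional subS su.
exists ((l, u - finite_rank s u) :: s) => v.
rewrite inE /= big_cons /= -/(finite_rank s v) => /orP[/eqP->|vw].
  by rewrite lu scale1r subrK.
by rewrite lS ?scale0r ?add0r; apply: sP.
Qed.

Lemma ptensor_suml U V (I : Type) (r : seq I) (F : I -> U) (v : V) :
  ptensor (\sum_(i <- r) F i) v = \sum_(i <- r) ptensor (F i) v.
Proof. exact: (linear_sum (ptensor_l U v)). Qed.

Lemma ptensor_sumr U V (I : Type) (r : seq I) (u : U) (F : I -> V) :
  ptensor u (\sum_(i <- r) F i) = \sum_(i <- r) ptensor u (F i).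
Proof. exact: (linear_sum (ptensor_r V u)). Qed.

Lemma ptensorZ U V (a : K) (u : U) (v : V) :
  ptensor (a *: u) v = ptensor u (a *: v).
Proof.
transitivity (a *: ptensor u v); first exact: (linearZZ (ptensor_l U v)).
by symmetry; exact: (linearZZ (ptensor_r V u)).
Qed.

Lemma bilinear_contract U V (l : {linear U -> K^o}) :
  bilin (fun (u : U) (v : V) => (l u : K) *: v).
Proof.
split=> [v a x y | u a x y] /=; first by rewrite linearP scalerDl scalerA.
by rewrite scalerDr !scalerA [X in X *: x]mulrC.
Qed.

(** [l (x) id : U (x) V -> K (x) V = V], the [l]-coordinate. *)
Definition contract U V (l : {linear U -> K^o}) : {linear tensor U V -> V} :=
  linear_of (tlift_linear (bilinear_contract V l)).

Lemma contractE U V (l : {linear U -> K^o}) (u : U) (v : V) :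
  contract V l (ptensor u v) = (l u : K) *: v.
Proof. exact: (tlift_ptensor _ _ (bilinear_contract V l)). Qed.

Lemma contract_tmap U V W (l : {linear U -> K^o}) (f : {linear V -> W}) y :
  f (contract V l y) = contract W l (tmap idfun f y).
Proof.
move: y; apply: (@tensor_ext K U V W (f \o contract V l) (contract W l \o tmap idfun f)).
move=> u v; change (f (contract V l (ptensor u v)) = contract W l (tmap idfun f (ptensor u v))).
by rewrite tmapE !contractE linearZ.
Qed.

(** The [u_i] in [y = sum_i u_i (x) v_i] are fixed by some finite-rank operator
    [u |-> sum_k l_k u *: e_k], so [y = sum_k e_k (x) (l_k (x) id) y]. *)
Lemma contract_eq0 U V (y : tensor U V) :
  (forall l, contract V l y = 0) -> y = 0.
Proof.
move=> y0; have [s sP] := finite_rank_identity (map fst (repr y)).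
rewrite [y]tensor_sum (_ : \sum_(p <- _) _ = \sum_(p <- s) ptensor p.2 (contract V p.1 y)).
  by rewrite big1 // => p _; rewrite y0 ptensor0r.
rewrite big_seq [in RHS](tensor_sum y).
transitivity (\sum_(q <- repr y | q \in repr y)
    \sum_(p <- s) ptensor p.2 ((p.1 q.1 : K) *: q.2)).
  apply: eq_bigr => q qy; rewrite -{1}(sP q.1) ?map_f //.
  by rewrite /= ptensor_suml; apply: eq_bigr => p _; rewrite ptensorZ.
rewrite -big_seq exchange_big; apply: eq_bigr => p _.
rewrite linear_sum ptensor_sumr.
by apply: eq_bigr => q _; rewrite contractE.
Qed.

(** [y] lies in [span w (x) V].  Stated by equations, this condition can be tested on
    the images of [y] under a jointly injective family of maps out of [V]. *)
Definition supported U V (w : seq U) (y : tensor U V) : Prop :=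
  forall l : {linear U -> K^o}, (forall u, u \in w -> l u = 0) -> contract V l y = 0.

Lemma supportedS U V (w w' : seq U) (y : tensor U V) :
  {subset w <= w'} -> supported w y -> supported w' y.
Proof. by move=> ww' wy l l0; apply: wy => u /ww' /l0. Qed.

Lemma exists_support U V (y : tensor U V) : exists w, supported w y.
Proof.
exists (map fst (repr y)) => l l0; rewrite [y]tensor_sum linear_sum big_seq big1 // => p py.
by rewrite contractE l0 ?scale0r // map_f.
Qed.

(** Apply a functional [l] to the difference of the two sides: the result is the
    coordinate of [y] for the functional [l - l \o finite_rank s], which vanishes
    on [w]. *)
Lemma supported_sum U V (w : seq U) (s : seq ({linear U -> K^o} * U)) (y : tensor U V) :
  (forall u, u \in w -> finite_rank s u = u) ->
  supported w y -> \sum_(p <- s) ptensor p.2 (contract V p.1 y) = y.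
Proof.
move=> sP wy; apply/eqP; rewrite eq_sym -subr_eq0; apply/eqP/contract_eq0 => l.
have := wy (l \- (l \o finite_rank s)) => <-; last first.
  by move=> u uw; change (l u - l (finite_rank s u) = 0); rewrite (sP _ uw) subrr.
move: y {wy}; apply: (@tensor_ind K U V) => [|x z IHx IHz|u v].
- by rewrite big1 ?subr0 ?linear0 // => p _; rewrite linear0 ptensor0r.
- rewrite [RHS]linearD -IHx -IHz -linearD; congr (contract V l _).
  rewrite addrACA -opprD -big_split; congr (_ - _).
  by apply: eq_bigr => p _; rewrite linearD ptensorDr.
rewrite [RHS]contractE.
transitivity ((l u - l (finite_rank s u) : K) *: v) => //.
rewrite linearB contractE scalerBl; congr (_ - _).
rewrite !linear_sum scaler_suml.
apply: eq_bigr => p _; rewrite !contractE linearZZ scalerA.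
by congr (_ *: _); symmetry; exact: (linearZZ l).
Qed.
End LinearAlgebra.

(** * The algebra of relations common to a class of valuations *)

(** Expressions in the language of [K]-algebras with variables in [X]. *)
Inductive aterm (K X : Type) : Type :=
| AVar of X
| AOne
| AAdd of aterm K X & aterm K X
| AMul of aterm K X & aterm K X
| AScale of K & aterm K X.
Arguments AOne {K X}.
Arguments AVar {K X} x.
HB.instance Definition _ (K X : Type) := gen_eqMixin (aterm K X).
HB.instance Definition _ (K X : Type) := gen_choiceMixin (aterm K X).

Section ValuationAlgebra.
Variables (K : fieldType) (X : Type).
Variable C : forall R : algebra K, (X -> R) -> Prop.

Fixpoint aeval (R : algebra K) (e : X -> R) (t : aterm K X) : R :=
  match t with
  | AVar x => e x
  | AOne => 1
  | AAdd t1 t2 => aeval e t1 + aeval e t2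
  | AMul t1 t2 => aeval e t1 * aeval e t2
  | AScale c t1 => c *: aeval e t1
  end.

(** Identities valid under every valuation of the class [C].  The algebra laws hold
    under all valuations, hence the classes of terms form an algebra with no further
    relations to impose. *)
Definition aeqv (s t : aterm K X) : bool :=
  `[< forall (R : algebra K) (e : X -> R), C e -> aeval e s = aeval e t >].

Lemma aeqvP s t : reflect
  (forall (R : algebra K) (e : X -> R), C e -> aeval e s = aeval e t) (aeqv s t).
Proof. exact: asboolP. Qed.
Lemma aeqv_refl : reflexive aeqv.
Proof. by move=> s; apply/aeqvP. Qed.
Lemma aeqv_sym : symmetric aeqv.
Proof. by move=> s t; apply/aeqvP/aeqvP => st R e Ce; rewrite st. Qed.
Lemma aeqv_trans : transitive aeqv.
Proof.
by move=> t s r /aeqvP st /aeqvP tr; apply/aeqvP => R e Ce; rewrite st ?tr.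
Qed.
Canonical aeqv_equiv := EquivRel aeqv aeqv_refl aeqv_sym aeqv_trans.

Definition valg : Type := {eq_quot aeqv}%qT.
HB.instance Definition _ := Choice.on valg.
HB.instance Definition _ := EqQuotient.on valg.

Local Notation vpi := (\pi_valg)%qT.

Definition veval (R : algebra K) (e : X -> R) (x : valg) : R := aeval e (repr x).

Lemma veval_pi (R : algebra K) (e : X -> R) t : C e -> veval e (vpi t) = aeval e t.
Proof.
have /aeqvP tt' : aeqv (repr (vpi t)) t by apply/eqmodP; rewrite reprK.
exact: tt'.
Qed.

Lemma valg_eq (x y : valg) :
  (forall (R : algebra K) (e : X -> R), C e -> veval e x = veval e y) -> x = y.
Proof. by move=> xy; rewrite -[x]reprK -[y]reprK; apply/eqmodP/aeqvP. Qed.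

Definition vgen (x : X) : valg := vpi (AVar x).
Definition vone : valg := vpi AOne.
Definition vadd (x y : valg) : valg := vpi (AAdd (repr x) (repr y)).
Definition vmul (x y : valg) : valg := vpi (AMul (repr x) (repr y)).
Definition vscale (c : K) (x : valg) : valg := vpi (AScale c (repr x)).
Definition vzero : valg := vscale 0 vone.
Definition vopp (x : valg) : valg := vscale (-1) x.

Section Evaluation.
Variables (R : algebra K) (e : X -> R).
Hypothesis Ce : C e.
Lemma veval_gen x : veval e (vgen x) = e x. Proof. exact: veval_pi. Qed.
Lemma veval_one : veval e vone = 1. Proof. exact: veval_pi. Qed.
Lemma veval_add x y : veval e (vadd x y) = veval e x + veval e y.
Proof. exact: veval_pi. Qed.
Lemma veval_mul x y : veval e (vmul x y) = veval e x * veval e y.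
Proof. exact: veval_pi. Qed.
Lemma veval_scale c x : veval e (vscale c x) = c *: veval e x.
Proof. exact: veval_pi. Qed.
Lemma veval_zero : veval e vzero = 0.
Proof. by rewrite veval_scale scale0r. Qed.
Lemma veval_opp x : veval e (vopp x) = - veval e x.
Proof. by rewrite veval_scale scaleN1r. Qed.
End Evaluation.
Definition vevalE :=
  (veval_zero, veval_opp, veval_add, veval_mul, veval_scale, veval_one).

Fact vaddA : associative vadd.
Proof. by move=> x y z; apply: valg_eq => R e Ce; rewrite !vevalE // addrA. Qed.
Fact vaddC : commutative vadd.
Proof. by move=> x y; apply: valg_eq => R e Ce; rewrite !vevalE // addrC. Qed.
Fact vadd0 : left_id vzero vadd.
Proof. by move=> x; apply: valg_eq => R e Ce; rewrite !vevalE // add0r. Qed.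
Fact vaddN : left_inverse vzero vopp vadd.
Proof. by move=> x; apply: valg_eq => R e Ce; rewrite !vevalE // addNr. Qed.
HB.instance Definition _ := GRing.isZmodule.Build valg vaddA vaddC vadd0 vaddN.

Fact vscaleA a b x : vscale a (vscale b x) = vscale (a * b) x.
Proof. by apply: valg_eq => R e Ce; rewrite !vevalE // scalerA. Qed.
Fact vscale1 : left_id 1 vscale.
Proof. by move=> x; apply: valg_eq => R e Ce; rewrite !vevalE // scale1r. Qed.
Fact vscaleDr : right_distributive vscale +%R.
Proof.
move=> a x y; apply: (@valg_eq (vscale a (vadd x y)) (vadd _ _)) => R e Ce.
by rewrite !vevalE // scalerDr.
Qed.
Fact vscaleDl x : {morph vscale^~ x : a b / a + b}.
Proof.
move=> a b; apply: (@valg_eq _ (vadd _ _)) => R e Ce.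
by rewrite !vevalE // scalerDl.
Qed.
HB.instance Definition _ :=
  GRing.Zmodule_isLmodule.Build K valg vscaleA vscale1 vscaleDr vscaleDl.

Fact vmulA : associative vmul.
Proof. by move=> x y z; apply: valg_eq => R e Ce; rewrite !vevalE // mulrA. Qed.
Fact vmul1l : left_id vone vmul.
Proof. by move=> x; apply: valg_eq => R e Ce; rewrite !vevalE // mul1r. Qed.
Fact vmul1r : right_id vone vmul.
Proof. by move=> x; apply: valg_eq => R e Ce; rewrite !vevalE // mulr1. Qed.
Fact vmulDl : left_distributive vmul +%R.
Proof.
move=> x y z; apply: (@valg_eq (vmul (vadd x y) z) (vadd _ _)) => R e Ce.
by rewrite !vevalE // mulrDl.
Qed.
Fact vmulDr : right_distributive vmul +%R.
Proof.
move=> x y z; apply: (@valg_eq (vmul x (vadd y z)) (vadd _ _)) => R e Ce.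
by rewrite !vevalE // mulrDr.
Qed.
HB.instance Definition _ := GRing.Zmodule_isPzRing.Build valg
  vmulA vmul1l vmul1r vmulDl vmulDr.

Fact vscaleAl (c : K) (x y : valg) : c *: (x * y) = (c *: x) * y.
Proof.
apply: (@valg_eq (vscale c (vmul x y)) (vmul (vscale c x) y)) => R e Ce.
by rewrite !vevalE // algscaleAl.
Qed.
Fact vscaleAr (c : K) (x y : valg) : c *: (x * y) = x * (c *: y).
Proof.
apply: (@valg_eq (vscale c (vmul x y)) (vmul x (vscale c y))) => R e Ce.
by rewrite !vevalE // algscaleAr.
Qed.

Definition valuation_algebra : algebra K :=
  @Algebra K valg (GRing.Lmodule.class valg) vscaleAl vscaleAr.

Definition vvar (x : X) : valuation_algebra := vgen x.

Section Extension.
Variables (R : algebra K) (e : X -> R).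
Hypothesis Ce : C e.

Lemma veval_linear : linear (veval e : valuation_algebra -> R).
Proof.
move=> a x y; change (veval e (vadd (vscale a x) y) = a *: veval e x + veval e y).
by rewrite !vevalE.
Qed.
Lemma veval_monoid : @monoid_morphism valuation_algebra R (linear_of veval_linear).
Proof.
by split=> [|x y]; [exact: veval_one | exact: veval_mul].
Qed.
Definition vext : algHom valuation_algebra R := AlgHom veval_monoid.

Lemma vextE x : vext (vvar x) = e x.
Proof. exact: veval_gen. Qed.
End Extension.

(** The algebra is the image of the free one in the product of all the [R] that carry
    a valuation of [C]. *)
Lemma valuation_algebra_sep (x y : valuation_algebra) :
  (forall (R : algebra K) (e : X -> R) (Ce : C e), vext Ce x = vext Ce y) -> x = y.
Proof. by move=> xy; apply: valg_eq => R e Ce; exact: xy Ce. Qed.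

Lemma valuation_algebra_ind (P : valuation_algebra -> Prop) :
  P 1 -> (forall x, P (vvar x)) -> (forall x y, P x -> P y -> P (x + y)) ->
  (forall x y, P x -> P y -> P (x * y)) -> (forall c x, P x -> P (c *: x)) ->
  forall x, P x.
Proof.
move=> P1 Pv PD PM PZ x; rewrite -[x]reprK.
elim: (repr x) => [z||s IHs t IHt|s IHs t IHt|c s IHs]; first exact: Pv.
- exact: P1.
- rewrite (_ : vpi _ = (vpi s : valuation_algebra) + vpi t); first exact: PD.
  apply: (@valg_eq _ (vadd _ _)) => R e Ce.
  by rewrite veval_add // !veval_pi.
- rewrite (_ : vpi _ = (vpi s : valuation_algebra) * vpi t); first exact: PM.
  apply: (@valg_eq _ (vmul _ _)) => R e Ce.
  by rewrite veval_mul // !veval_pi.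
rewrite (_ : vpi _ = c *: (vpi s : valuation_algebra)); first exact: PZ.
apply: (@valg_eq _ (vscale _ _)) => R e Ce.
by rewrite veval_scale // !veval_pi.
Qed.

Lemma valuation_algebra_hom_eq (R : algebra K) (f g : algHom valuation_algebra R) :
  (forall x, f (vvar x) = g (vvar x)) -> f = g.
Proof.
move=> fg; apply: algHomP; apply: valuation_algebra_ind => //.
- by rewrite !algHom1.
- by move=> x y fx fy; rewrite !linearD fx fy.
- by move=> x y fx fy; rewrite !algHomM fx fy.
by move=> c x fx; rewrite !linearZ /= fx.
Qed.

Lemma valuation_algebra_commutative :
  (forall (R : algebra K) (e : X -> R), C e -> alg_commutative R) ->
  alg_commutative valuation_algebra.
Proof.
move=> comC x y; apply: valuation_algebra_sep => R e Ce.
by rewrite !algHomM (comC _ _ Ce).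
Qed.
End ValuationAlgebra.

(** * Families and representability in a category with a tensor product *)

Local Notation mcompA := Defs.compA.

(** Algebras and pro-algebras share only a functorial tensor product and the
    interchange of the two middle factors; what follows from these is proved for both
    at once. *)
Section TensorCategory.
Variables (M : category) (T : M -> M -> M).
Variable Tm : forall a a' b b', mor a a' -> mor b b' -> mor (T a b) (T a' b').
Hypothesis Tm_id : forall a b, Tm (idm a) (idm b) = idm (T a b).
Hypothesis Tm_comp : forall a a' a'' b b' b''
  (f' : mor a' a'') (f : mor a a') (g' : mor b' b'') (g : mor b b'),
  Tm f' g' \oc Tm f g = Tm (f' \oc f) (g' \oc g).

Lemma Tm_compr x a a' a'' b b' b'' (f' : mor a' a'') (f : mor a a')
    (g' : mor b' b'') (g : mor b b') (u : mor x (T a b)) :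
  Tm f' g' \oc (Tm f g \oc u) = Tm (f' \oc f) (g' \oc g) \oc u.
Proof. by rewrite mcompA Tm_comp. Qed.

Section Families.
Variable X : forall a b c d, mor (T (T a b) (T c d)) (T (T a c) (T b d)).
Hypothesis X_natural : forall a a' b b' c c' d d'
  (f : mor a a') (g : mor b b') (h : mor c c') (k : mor d d'),
  Tm (Tm f h) (Tm g k) \oc X a b c d = X a' b' c' d' \oc Tm (Tm f g) (Tm h k).

(** The right-hand side of the condition defining families of Hopf algebra morphisms. *)
Definition twisted_square a b r (delta : mor a (T a a)) (mu : mor (T r r) r)
    (psi : mor a (T b r)) : mor a (T (T b b) r) :=
  Tm (idm (T b b)) mu \oc X b r b r \oc Tm psi psi \oc delta.

Lemma twisted_square_natural a a' b b' r r'
    (delta : mor a (T a a)) (delta' : mor a' (T a' a'))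
    (mu : mor (T r r) r) (mu' : mor (T r' r') r')
    (g : mor a a') (f : mor b b') (phi : mor r r') (psi : mor a' (T b r)) :
  delta' \oc g = Tm g g \oc delta -> phi \oc mu = mu' \oc Tm phi phi ->
  twisted_square delta mu' (Tm f phi \oc psi \oc g)
  = Tm (Tm f f) phi \oc twisted_square delta' mu psi \oc g.
Proof.
move=> deltag phimu; rewrite /twisted_square -!Tm_comp.
rewrite -!mcompA deltag (mcompA (X _ _ _ _)) -X_natural.
by rewrite -!mcompA !Tm_compr !comp_idl comp_idr phimu.
Qed.
End Families.

Section Representation.
Variables (C1 C2 D E : category) (F1 : functor C1 M) (F2 : functor C2 M).
Variables (L : functor E M) (J : functor D E).
Hypothesis J_full : forall (a b : D) (f : mor (J a) (J b)), exists g, fmap J g = f.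
Hypothesis J_faithful : forall (a b : D) (f g : mor a b), fmap J f = fmap J g -> f = g.
Variable Q : forall (x : C1) (y : C2) (r : E), mor (F1 x) (T (F2 y) (L r)) -> Prop.
Hypothesis Q_pre : forall (x x' : C1) (y y' : C2) (r : E) (g : mor x x') (f : mor y' y)
  (psi : mor (F1 x') (T (F2 y') (L r))),
  Q psi -> Q (Tm (fmap F2 f) (idm (L r)) \oc psi \oc fmap F1 g).
Hypothesis rep : forall x y, exists (a : D) (h : mor (F1 x) (T (F2 y) (L (J a)))),
  Q h /\ forall (r : E) (psi : mor (F1 x) (T (F2 y) (L r))), Q psi ->
    exists! phi : mor (J a) r, psi = Tm (idm (F2 y)) (fmap L phi) \oc h.

(** The arrow attached to [(g, f)] classifies the composite of the universal element
    for the target with [g] and [f]; uniqueness of classifying arrows gives the functor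
    laws.  The representing objects live in [D], whereas the test objects [r] range
    over the larger [E]: finitely generated pro-algebras represent families with
    arbitrary commutative coefficients. *)
Lemma representing_functor :
  exists (A : functor (prodcat C1 (opcat C2)) D)
         (h : forall x y, mor (F1 x) (T (F2 y) (L (J (A (x, y)))))),
    [/\ forall x y, Q (h x y),
        forall (x x' : C1) (y y' : C2) (g : mor x x') (f : mor y' y),
          Tm (idm (F2 y)) (fmap L (fmap J (@fmap _ _ A (x, y) (x', y') (g, f)))) \oc h x y
          = Tm (fmap F2 f) (idm (L (J (A (x', y'))))) \oc h x' y' \oc fmap F1 g
      & forall x y r (psi : mor (F1 x) (T (F2 y) (L r))), Q psi ->
          exists! phi : mor (J (A (x, y))) r,
            psi = Tm (idm (F2 y)) (fmap L phi) \oc h x y].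
Proof.
pose a x y := sval (cid (rep x y)).
pose h x y : mor (F1 x) (T (F2 y) (L (J (a x y)))) := sval (cid (svalP (cid (rep x y)))).
have hP x y := svalP (cid (svalP (cid (rep x y)))).
have hQ x y : Q (h x y) by have [] := hP x y.
have hU x y r (psi : mor (F1 x) (T (F2 y) (L r))) : Q psi ->
    exists! phi : mor (J (a x y)) r, psi = Tm (idm (F2 y)) (fmap L phi) \oc h x y.
  by have [_] := hP x y; apply.
(* Arrows of [D] are determined by their effect on the universal element. *)
have hJ x y b (u v : mor (a x y) b) :
    Q (Tm (idm (F2 y)) (fmap L (fmap J u)) \oc h x y) ->
    Tm (idm (F2 y)) (fmap L (fmap J u)) \oc h x y
    = Tm (idm (F2 y)) (fmap L (fmap J v)) \oc h x y -> u = v.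
  move=> Qu uv; have [w [_ wP]] := hU _ _ _ _ Qu.
  by apply: J_faithful; rewrite -(wP _ erefl) -(wP _ uv).
pose ind (p q : C1 * C2) (gf : mor p.1 q.1 * mor q.2 p.2) :=
  Tm (fmap F2 gf.2) (idm _) \oc h q.1 q.2 \oc fmap F1 gf.1.
have indQ p q gf : Q (@ind p q gf) by apply: Q_pre.
have ex_arrow p q gf : exists u : mor (a p.1 p.2) (a q.1 q.2),
    Tm (idm _) (fmap L (fmap J u)) \oc h p.1 p.2 = @ind p q gf.
  by have [u [e _]] := hU _ _ _ _ (indQ p q gf); have [v vu] := J_full u; exists v; rewrite vu.
pose arrow p q gf := sval (cid (ex_arrow p q gf)).
have arrowP p q gf : Tm (idm _) (fmap L (fmap J (arrow p q gf))) \oc h p.1 p.2 = ind p q gf.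
  by rewrite /arrow; case: cid.
have arrow_id p : arrow p p (idm p.1, idm p.2) = idm (a p.1 p.2).
  apply: hJ; first by rewrite arrowP; apply: indQ.
  by rewrite arrowP /ind /= !fmap_id !Tm_id comp_idl comp_idr.
have arrow_comp (p q s : C1 * C2) (vg : mor q.1 s.1 * mor s.2 q.2)
    (uf : mor p.1 q.1 * mor q.2 p.2) :
    arrow p s (vg.1 \oc uf.1, uf.2 \oc vg.2) = arrow q s vg \oc arrow p q uf.
  apply: hJ; first by rewrite arrowP; apply: indQ.
  rewrite arrowP !fmap_comp -[idm (F2 p.2)]comp_idl -Tm_comp -mcompA arrowP /ind.
  rewrite /= !fmap_comp -!mcompA Tm_compr comp_idl comp_idr.
  rewrite -[fmap F2 uf.2]comp_idr -[fmap L _]comp_idl -Tm_compr.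
  rewrite (mcompA (Tm (idm _) _) (h _ _)) arrowP /ind -!mcompA Tm_compr.
  by rewrite comp_idl comp_idr.
exists (@Functor (prodcat C1 (opcat C2)) D (fun p => a p.1 p.2) arrow arrow_id
  (fun p q s vg uf => arrow_comp p q s vg uf)), h.
by split=> // x x' y y' g f; exact: (arrowP (x, y) (x', y') (g, f)).
Qed.
End Representation.
End TensorCategory.

(** * The universal family with a given bound *)

Lemma tmul_sum (K : fieldType) (A B : algebra K) (I J : Type) (r : seq I) (s : seq J)
    (F : I -> tensor A B) (G : J -> tensor A B) :
  tmul (\sum_(i <- r) F i) (\sum_(j <- s) G j)
  = \sum_(i <- r) \sum_(j <- s) tmul (F i) (G j).
Proof.
transitivity (\sum_(i <- r) tmul (F i) (\sum_(j <- s) G j)).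
  exact: (linear_sum (linear_of ((bilinear_tmul A B).1 _))).
by apply: eq_bigr => i _; exact: (linear_sum (linear_of ((bilinear_tmul A B).2 _))).
Qed.

Section AlgebraFamilies.
Variable K : fieldType.
Implicit Types R S : ComAlg K.

Lemma acomult_natural (H H' : HopfAlg K) (u : mor H H') :
  acomult H' \oc fmap (hopf_forget K) u
  = atmap (fmap (hopf_forget K) u) (fmap (hopf_forget K) u) \oc acomult H.
Proof. by apply: algHomP => x; apply: (hopfHom_comult u). Qed.

Lemma is_familyE (H1 H2 : HopfAlg K) R
    (psi : mor (hopf_forget K H1) (atensor (hopf_forget K H2) (incl _ R))) :
  is_family psi <->
  atmap (acomult H2) (idm _) \oc psi
  = twisted_square (@atmap K) (@ainterchange K) (acomult H1) (amul R) psi.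
Proof. by []. Qed.

Definition family_square_natural :=
  twisted_square_natural (@atmap_comp K) (@ainterchange_natural K).

Lemma family_square_pre (H1 H2 H1' H2' : HopfAlg K) R S
    (g : mor H1 H1') (f : mor H2' H2) (phi : mor R S)
    (psi : mor (hopf_forget K H1') (atensor (hopf_forget K H2') (incl _ R))) :
  atmap (acomult H2) (idm _) \oc
    (atmap (fmap (hopf_forget K) f) (fmap (incl _) phi) \oc psi \oc fmap (hopf_forget K) g)
  = atmap (atmap (fmap (hopf_forget K) f) (fmap (hopf_forget K) f)) (fmap (incl _) phi) \oc
    (atmap (acomult H2') (idm _) \oc psi) \oc fmap (hopf_forget K) g.
Proof.
rewrite !mcompA !atmap_comp comp_idl comp_idr; congr (atmap _ _ \oc _ \oc _).
exact: acomult_natural.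
Qed.

Lemma is_family_map (H1 H2 H1' H2' : HopfAlg K) R S
    (g : mor H1 H1') (f : mor H2' H2) (phi : mor R S)
    (psi : mor (hopf_forget K H1') (atensor (hopf_forget K H2') (incl _ R))) :
  is_family psi ->
  is_family (atmap (fmap (hopf_forget K) f) (fmap (incl _) phi)
    \oc psi \oc fmap (hopf_forget K) g).
Proof.
move=> /is_familyE fam; apply/is_familyE; rewrite family_square_pre fam.
symmetry; apply: family_square_natural; last exact: amul_natural.
exact: acomult_natural.
Qed.

(** The maps underlying families, as algebra morphisms that can be evaluated. *)
Definition hom_family (H1 H2 : HopfAlg K) R : Type :=
  algHom (hopf_forget K H1) (tensor_alg (hopf_forget K H2) (incl _ R)).

Section BoundedFamilies.
Variables (H1 H2 : HopfAlg K).
Local Notation A1 := (hopf_forget K H1 : algebra K).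
Local Notation A2 := (hopf_forget K H2 : algebra K).

Definition bounded (b : A1 -> seq A2) R (psi : hom_family H1 H2 R) : Prop :=
  forall x, supported (b x) (psi x).

Lemma exists_bound R (psi : hom_family H1 H2 R) : exists b, bounded b psi.
Proof.
have [b bP] := choice (fun x => exists_support (psi x)).
by exists b.
Qed.

Lemma boundedS (b b' : A1 -> seq A2) R (psi : hom_family H1 H2 R) :
  (forall x, {subset b x <= b' x}) -> bounded b psi -> bounded b' psi.
Proof. by move=> bb' bpsi x; apply: supportedS (bpsi x). Qed.

(** The matrix coefficients of [psi]; by [contract_eq0] they determine [psi]. *)
Definition coordinates R (psi : hom_family H1 H2 R) (p : A1 * {linear A2 -> K^o}) : incl _ R :=
  contract _ p.2 (psi p.1).

Variable b : A1 -> seq A2.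

(** The class of valuations whose common relations define the universal algebra. *)
Definition bounded_coordinates (R : algebra K) (e : A1 * {linear A2 -> K^o} -> R) : Prop :=
  exists (comR : alg_commutative R) (psi : hom_family H1 H2 (FullObj comR)),
    [/\ @is_family K H1 H2 (FullObj comR) psi, bounded b psi & e = coordinates psi].

Definition universal_alg : algebra K := valuation_algebra bounded_coordinates.

Lemma universal_alg_com : alg_commutative universal_alg.
Proof. by apply: valuation_algebra_commutative => R e [comR _]. Qed.

Definition universal_ob : ComAlg K := @FullObj (Alg K) _ universal_alg universal_alg_com.

Lemma bounded_coordinatesP R (psi : hom_family H1 H2 R) :
  @is_family K H1 H2 R psi -> bounded b psi -> bounded_coordinates (coordinates psi).
Proof. by case: R psi => R comR psi fam bpsi; exists comR, psi. Qed.

Definition classifying R (psi : hom_family H1 H2 R)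
    (Ce : bounded_coordinates (coordinates psi)) : algHom universal_alg (incl _ R) := vext Ce.

Lemma universal_alg_sep (x y : universal_alg) :
  (forall R (psi : hom_family H1 H2 R) (Ce : bounded_coordinates (coordinates psi)),
     @is_family K H1 H2 R psi -> bounded b psi -> classifying Ce x = classifying Ce y) ->
  x = y.
Proof.
move=> xy; apply: valuation_algebra_sep => R e Ce; case: (Ce) => comR [psi [fam bpsi eE]].
by subst e; apply: (xy (FullObj comR) psi).
Qed.

Definition projections (x : A1) : seq ({linear A2 -> K^o} * A2) :=
  sval (cid (finite_rank_identity (b x))).

Lemma projectionsP x u : u \in b x -> finite_rank (projections x) u = u.
Proof. by rewrite /projections; case: cid => s sP /=; apply: sP. Qed.

(** [psi x] is recovered from finitely many of its coordinates as in [supported_sum];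
    here the coordinates are replaced by the corresponding generators. *)
Definition universal_fun (x : A1) : tensor A2 universal_alg :=
  \sum_(p <- projections x) ptensor p.2 (vvar bounded_coordinates (x, p.1)).

Lemma universal_funE R (psi : hom_family H1 H2 R) (Ce : bounded_coordinates (coordinates psi)) x :
  bounded b psi -> tmap idfun (classifying Ce) (universal_fun x) = psi x.
Proof.
move=> bpsi; rewrite linear_sum -[RHS](supported_sum (@projectionsP x) (bpsi x)).
by apply: eq_bigr => p _; rewrite tmapE /classifying vextE.
Qed.

(** Joint injectivity of the specializations survives tensoring with a vector space:
    take the [l]-coordinate of a difference and apply [universal_alg_sep]. *)
Lemma universal_sep (U : lmodType K) (y y' : tensor U universal_alg) :
  (forall R (psi : hom_family H1 H2 R) (Ce : bounded_coordinates (coordinates psi)),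
     is_family (psi : mor (hopf_forget K H1) (atensor (hopf_forget K H2) (incl _ R))) ->
     bounded b psi ->
     tmap idfun (classifying Ce) y = tmap idfun (classifying Ce) y') -> y = y'.
Proof.
move=> yy'; apply/eqP; rewrite -subr_eq0; apply/eqP/contract_eq0 => l.
apply: universal_alg_sep => R psi Ce fam bpsi.
by rewrite (contract_tmap l) linearB (yy' R psi Ce fam bpsi) subrr !linear0.
Qed.

Lemma universal_fun_linear : linear universal_fun.
Proof.
move=> a x y; apply: universal_sep => R psi Ce fam bpsi.
by rewrite linearP !universal_funE // linearP.
Qed.

Lemma universal_fun_monoid :
  @monoid_morphism A1 (tensor_alg A2 universal_alg) (linear_of universal_fun_linear).
Proof.
have tmapM R (psi : hom_family H1 H2 R) (Ce : bounded_coordinates (coordinates psi)) :=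
  @tmap_monoid K A2 A2 _ _ (algHom_id A2) (classifying Ce).
split=> [|x y]; apply: universal_sep => R psi Ce fam bpsi.
  rewrite universal_funE // algHom1.
  by have [] := tmapM _ _ Ce.
have [_ tM] := tmapM _ _ Ce.
transitivity (tmap idfun (classifying Ce) (universal_fun x) * tmap idfun (classifying Ce) (universal_fun y)
  :> tensor_alg A2 (incl _ R)); last by symmetry; apply: tM.
by rewrite !universal_funE // algHomM.
Qed.

Definition universal_family : hom_family H1 H2 universal_ob := AlgHom universal_fun_monoid.

Lemma classifyingE R (psi : hom_family H1 H2 R) (Ce : bounded_coordinates (coordinates psi)) :
  bounded b psi ->
  atmap (idm (hopf_forget K H2)) (fmap (incl _) (classifying Ce : mor universal_ob R))
    \oc (universal_family : mor (hopf_forget K H1) _) = psi.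
Proof. by move=> bpsi; apply: algHomP => x; apply: universal_funE. Qed.

Lemma universal_sep_mor (X Y : Alg K) (u v : mor X (atensor Y (incl _ universal_ob))) :
  (forall R (psi : hom_family H1 H2 R) (Ce : bounded_coordinates (coordinates psi)),
     is_family (psi : mor (hopf_forget K H1) (atensor (hopf_forget K H2) (incl _ R))) ->
     bounded b psi ->
     atmap (idm Y) (fmap (incl _) (classifying Ce : mor universal_ob R)) \oc u
     = atmap (idm Y) (fmap (incl _) (classifying Ce : mor universal_ob R)) \oc v) -> u = v.
Proof.
move=> uv; apply: algHomP => x; apply: universal_sep => R psi Ce fam bpsi.
exact: (congr1 (fun w : algHom X (tensor_alg Y (incl _ R)) => w x) (uv R psi Ce fam bpsi)).
Qed.

(** Every bounded specialization satisfies the condition, and both of its sides are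
    natural in the algebra of coefficients. *)
Lemma universal_family_is_family : @is_family K H1 H2 universal_ob universal_family.
Proof.
apply/is_familyE/universal_sep_mor => R psi Ce fam bpsi.
have := @family_square_pre H1 H2 H1 H2 _ _ (idm _) (idm _) (classifying Ce : mor universal_ob R) universal_family.
rewrite !fmap_id !comp_idr classifyingE // atmap_id => <-.
rewrite fam -[in LHS](classifyingE Ce bpsi).
have := family_square_natural (idm (hopf_forget K H2)) universal_family (acomult_natural (idm H1))
  (amul_natural (classifying Ce : mor universal_ob R)).
by rewrite !fmap_id !comp_idr atmap_id.
Qed.

Lemma universal_family_bounded : bounded b universal_family.
Proof.
move=> x l l0; apply: universal_alg_sep => R psi Ce fam bpsi.
by rewrite (contract_tmap l) universal_funE // bpsi ?linear0.
Qed.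

(** Even for functionals [l] outside the finite list used to build the universal
    family; this is where generators for different functionals become related. *)
Lemma universal_coordinates x l :
  contract universal_alg l (universal_family x) = vvar bounded_coordinates (x, l).
Proof.
apply: universal_alg_sep => R psi Ce fam bpsi.
by rewrite (contract_tmap l) universal_funE // /classifying vextE.
Qed.

Lemma classifying_unique R (phi phi' : mor universal_ob R) :
  atmap (idm (hopf_forget K H2)) (fmap (incl _) phi)
    \oc (universal_family : mor (hopf_forget K H1) _)
  = atmap (idm (hopf_forget K H2)) (fmap (incl _) phi')
    \oc (universal_family : mor (hopf_forget K H1) _) -> phi = phi'.
Proof.
move=> e; apply: valuation_algebra_hom_eq => -[x l].
rewrite -universal_coordinates !contract_tmap; congr (contract _ l _).
exact: (congr1 (fun w : algHom A1 (tensor_alg A2 (incl _ R)) => w x) e).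
Qed.

(** The elements of [H1] all of whose coordinates lie in a given subalgebra [S] form
    a subalgebra, because a product of two tensors with right factors in [S] is again
    one; and each [x] has finitely many coordinates that generate the others. *)
Lemma universal_alg_fg : alg_fg A1 -> alg_fg universal_alg.
Proof.
move=> [s sP].
exists (flatten [seq [seq vvar bounded_coordinates (x, p.1) | p <- projections x] | x <- s]).
move=> S [S1 Slin SM] sS.
have S0 : 0 \in S by rewrite -(addNr 1) -scaleN1r; apply: Slin.
have SZ a u : u \in S -> a *: u \in S by move=> Su; rewrite -[_ *: _]addr0; apply: Slin.
have SD u v : u \in S -> v \in S -> u + v \in S.
  by move=> Su Sv; rewrite -[u]scale1r; apply: Slin.
have coordS x : {subset [seq vvar bounded_coordinates (x, p.1) | p <- projections x] <= S} ->
    forall l, vvar bounded_coordinates (x, l) \in S.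
  move=> /allP; rewrite all_map => xS l; rewrite -universal_coordinates linear_sum.
  rewrite (eq_bigr _ (fun p _ => contractE l p.2 _)).
  elim: (projections x) xS => [|p r IH] /=; first by rewrite big_nil.
  case/andP=> pS /IH rS; rewrite big_cons.
  by apply: SD => //; apply: SZ.
pose T : {pred A1} := fun x => `[< forall l, vvar bounded_coordinates (x, l) \in S >].
have TS : forall x, x \in T.
  apply: sP.
    split.
    - apply/asboolP => l; rewrite -universal_coordinates algHom1 contractE.
      exact: SZ.
    - move=> a x y /asboolP xS /asboolP yS; apply/asboolP => l.
      rewrite -universal_coordinates !linearP; apply: Slin;
        by rewrite universal_coordinates.
    move=> x y /asboolP xS /asboolP yS; apply/asboolP => l.
    rewrite -universal_coordinates algHomM.
    rewrite [_ * _]tmul_sum linear_sum; apply: (big_ind (fun y => y \in S)) => // p _.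
    rewrite linear_sum; apply: (big_ind (fun y => y \in S)) => // q _.
    rewrite tmulE contractE; apply: SZ; exact: SM.
  move=> x xs; apply/asboolP; apply: coordS => u xu; apply: sS.
  apply/flattenP; exists [seq vvar bounded_coordinates (x, p.1) | p <- projections x] => //.
  exact: (map_f (fun x => [seq vvar bounded_coordinates (x, p.1) | p <- projections x])).
apply: valuation_algebra_ind => //; first by move=> [x l]; have /asboolP := TS x; apply.
Qed.
End BoundedFamilies.
End AlgebraFamilies.

(** * Pro-families, level by level *)

Section Levels.
Variable C : category.

(** A colimit over a one-element index set is the set of morphisms itself. *)
Definition unconst (c d : C) (x : colim (pro_const_ob c) d) : mor c d :=
  tagged (germ_repr x).

Lemma unconstK (c d : C) (x : colim (pro_const_ob c) d) :
  germ_class (Tagged (fun i => mor (pro_const_ob c i) d) (unconst x : mor (pro_const_ob c tt) d)) = x.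
Proof. by rewrite -[RHS]germ_reprK /unconst; case: (germ_repr x) => -[]. Qed.

Lemma unconst_class (c d : C) (f : mor c d) :
  unconst (germ_class (Tagged (fun i => mor (pro_const_ob c i) d) (f : mor (pro_const_ob c tt) d))) = f.
Proof.
have [k [h [h' e]]] := germ_class_repr (Tagged (fun i => mor (pro_const_ob c i) d) (f : mor (pro_const_ob c tt) d)).
by move: e; rewrite /= !comp_idr.
Qed.

Lemma unconst_post (c d d' : C) (u : mor d d') (x : colim (pro_const_ob c) d) :
  unconst (colim_post u x) = u \oc unconst x.
Proof. by rewrite -{1}[x]unconstK colim_post_class; exact: unconst_class. Qed.

Lemma unconst_inj (c d : C) : injective (@unconst c d).
Proof. by move=> x y xy; rewrite -[x]unconstK xy unconstK. Qed.
End Levels.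

Section Representatives.
Variable C : category.

(** The component of [F] at [p] is the class of [v].  Unlike the components
    themselves, representatives compose and tensor as ordinary morphisms do. *)
Definition represents (X Y : Pro C) (F : mor X Y) (p : pro_idx Y) (q : pro_idx X)
    (v : mor (pro_ob q) (pro_ob p)) : Prop :=
  sval F p = germ_class (Tagged (fun i => mor (X i) (Y p)) v).

Lemma exists_representative (X Y : Pro C) (F : mor X Y) p :
  exists q v, @represents X Y F p q v.
Proof. by rewrite /represents; elim/colim_ind: (sval F p) => q v; exists q, v. Qed.

Lemma represents_id (X : Pro C) (p : pro_idx X) : represents (idm X) (idm (pro_ob p)).
Proof. by []. Qed.

Lemma represents_comp (X Y Z : Pro C) (G : mor Y Z) (F : mor X Y) p q o
    (v : mor (pro_ob q) (pro_ob p)) (w : mor (pro_ob o) (pro_ob q)) :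
  represents G v -> represents F w -> represents (G \oc F) (v \oc w).
Proof.
rewrite /represents => Gv Fw.
change (colim_comp (sval G p) F = germ_class (Tagged (fun i => mor (X i) (Z p)) (v \oc w))).
by rewrite Gv colim_comp_class Fw colim_post_class.
Qed.
End Representatives.

Lemma represents_map (C D : category) (F : functor C D) (X Y : Pro C) (f : mor X Y) p q
    (v : mor (pro_ob q) (pro_ob p)) :
  represents f v -> represents (fmap (pro_map F) f) (fmap F v : mor (pro_map_ob F X q) (pro_map_ob F Y p)).
Proof.
rewrite /represents => fv.
by rewrite -(colim_map_class F (Tagged (fun i => mor (X i) (Y p)) v)) -fv.
Qed.

Lemma represents_tensor (K : fieldType) (X Y X' Y' : Pro (Alg K)) (f : mor X X') (g : mor Y Y')
    p q p' q' (u : mor (pro_ob q) (pro_ob p)) (v : mor (pro_ob q') (pro_ob p')) :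
  represents f u -> represents g v ->
  represents (prmap f g) (atmap u v : mor (prtensor_ob X Y (q, q')) (prtensor_ob X' Y' (p, p'))).
Proof.
rewrite /represents => fu gv.
change (colim_tensor (sval f p) (sval g p')
  = germ_class (@Tagged (pro_idx (prtensor_ob X Y)) (q, q')
      (fun i => mor (prtensor_ob X Y i) (prtensor_ob X' Y' (p, p'))) (atmap u v))).
by rewrite fu gv colim_tensor_class.
Qed.

Section ProFamilyLevels.
Variable K : fieldType.
Variables H1 H2 : HopfAlg K.
Implicit Types R S : Pro (ComAlg K).

Definition pro_hom_family R := mor (hopf_pro H1) (prtensor (hopf_pro H2) (com_pro K R)).

(** The constant source makes each component of a pro-family a single morphism. *)
Definition level R (psi : pro_hom_family R) (j : pro_idx R) : hom_family H1 H2 (@pro_ob _ R j) :=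
  unconst (sval psi (tt, j)).

Lemma represents_level R (psi : pro_hom_family R) j :
  @represents _ _ _ psi (tt, j) tt (level psi j).
Proof. by rewrite /represents -[LHS]unconstK. Qed.

Lemma level_unique R (psi : pro_hom_family R) j v :
  @represents _ _ _ psi (tt, j) tt v -> level psi j = v.
Proof. by rewrite /level => ->; exact: (@unconst_class (Alg K) (hopf_forget K H1) _ v). Qed.

Lemma level_inj R (psi psi' : pro_hom_family R) :
  (forall j, level psi j = level psi' j) -> psi = psi'.
Proof. by move=> e; apply: proHomP => -[[] j]; apply: unconst_inj; apply: e. Qed.

Lemma level_tr R (psi : pro_hom_family R) (j j' : pro_idx R) (h : dir_le j j') :
  atmap (idm (hopf_forget K H2)) (fmap (incl _) (pro_tr h))
    \oc (level psi j' : mor (hopf_forget K H1) _) = level psi j.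
Proof.
have := svalP psi (tt, j) (tt, j') (conj I h) => /(congr1 (@unconst _ _ _)).
by rewrite unconst_post.
Qed.

Lemma pro_family_of_levels R (psi : forall j : pro_idx R, hom_family H1 H2 (@pro_ob _ R j)) :
  (forall (j j' : pro_idx R) (h : dir_le j j'),
    atmap (idm (hopf_forget K H2)) (fmap (incl _) (pro_tr h))
      \oc (psi j' : mor (hopf_forget K H1) _) = psi j) ->
  exists Psi : pro_hom_family R, forall j, level Psi j = psi j.
Proof.
move=> psi_tr.
have psi_tr' : forall (p p' : pro_idx (prtensor_ob (hopf_pro H2) (com_pro K R))) (h : dir_le p p'),
    pro_tr h \oc (psi p'.2 : mor (hopf_pro H1 tt) (prtensor_ob (hopf_pro H2) (com_pro K R) p'))
    = (psi p.2 : mor (hopf_pro H1 tt) (prtensor_ob (hopf_pro H2) (com_pro K R) p))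
      \oc pro_tr (I : dir_le (tt : pro_idx (hopf_pro H1)) tt).
  move=> p p' [h1 h2]; rewrite comp_idr; exact: (psi_tr _ _ h2).
exists (@pro_level (Alg K) (hopf_pro H1) (prtensor_ob (hopf_pro H2) (com_pro K R))
  (fun _ => tt) (fun _ _ _ => I) (fun p => psi p.2) psi_tr').
by move=> j; exact: (@unconst_class (Alg K) (hopf_forget K H1) _ (psi j)).
Qed.
End ProFamilyLevels.

Section ProFamilyMaps.
Variable K : fieldType.
Implicit Types R S : Pro (ComAlg K).

Lemma level_map (H1 H2 H1' H2' : HopfAlg K) R S (f : mor H2' H2) (g : mor H1 H1')
    (phi : mor R S) (psi : pro_hom_family H1' H2' R) (k : pro_idx S) (j : pro_idx R)
    (u : mor (@pro_ob _ R j) (@pro_ob _ S k)) :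
  represents phi u ->
  level (prmap (fmap (pro_const (Alg K)) (fmap (hopf_forget K) f)) (fmap (com_pro K) phi)
    \oc psi \oc fmap (pro_const (Alg K)) (fmap (hopf_forget K) g)) k
  = atmap (fmap (hopf_forget K) f) (fmap (incl _) u) \oc (level psi j : mor (hopf_forget K H1') _)
    \oc fmap (hopf_forget K) g.
Proof.
move=> phiu; apply: level_unique.
have Rf : @represents _ (hopf_pro H2') (hopf_pro H2)
  (fmap (pro_const (Alg K)) (fmap (hopf_forget K) f)) tt tt (fmap (hopf_forget K) f) by [].
have Rg : @represents _ (hopf_pro H1) (hopf_pro H1')
  (fmap (pro_const (Alg K)) (fmap (hopf_forget K) g)) tt tt (fmap (hopf_forget K) g) by [].
have T := represents_tensor Rf (represents_map (incl _) phiu).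
have T1 := represents_comp T (represents_level psi j).
exact: (represents_comp T1 Rg).
Qed.

(** At the index [((tt, tt), j)] the two sides of the condition on [psi] are
    represented by the two sides of the condition on its level at [j]. *)
Lemma is_pro_family_level (H1 H2 : HopfAlg K) R (psi : pro_hom_family H1 H2 R) :
  is_pro_family psi <-> forall j, @is_family K H1 H2 _ (level psi j).
Proof.
set lhs := prmap (prcomult H2) (idm (com_pro K R)) \oc psi.
set rhs := prmap (idm (prtensor (hopf_pro H2) (hopf_pro H2))) (prmul R)
  \oc printerchange (hopf_pro H2) (com_pro K R) (hopf_pro H2) (com_pro K R)
  \oc prmap psi psi \oc prcomult H1.
have lhsP (j : pro_idx R) : @represents _ _ _ lhs ((tt, tt), j) tt
    (atmap (acomult H2) (idm _) \oc level psi j).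
  have Rc : @represents _ (hopf_pro H2) _ (prcomult H2) (tt, tt) tt (acomult H2) by [].
  have T := represents_tensor Rc (@represents_id _ (com_pro K R) j).
  exact: (represents_comp T (represents_level psi j)).
have rhsP (j : pro_idx R) : @represents _ _ _ rhs ((tt, tt), j) tt
    (twisted_square (@atmap K) (@ainterchange K) (acomult H1) (amul (@pro_ob _ R j)) (level psi j)).
  have Rc : @represents _ (hopf_pro H1) _ (prcomult H1) (tt, tt) tt (acomult H1) by [].
  have Rm : @represents _ _ _ (prmul R) j (j, j) (amul (@pro_ob _ R j)) by [].
  have Ri : @represents _ _ _ (printerchange (hopf_pro H2) (com_pro K R) (hopf_pro H2) (com_pro K R))
    ((tt, tt), (j, j)) ((tt, j), (tt, j)) (ainterchange _ _ _ _) by [].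
  have T1 := represents_tensor (@represents_id _ (prtensor (hopf_pro H2) (hopf_pro H2)) (tt, tt)) Rm.
  have T2 := represents_tensor (represents_level psi j) (represents_level psi j).
  exact: (represents_comp (represents_comp (represents_comp T1 Ri) T2) Rc).
split=> [e j | e].
  apply/is_familyE.
  have := lhsP j; rewrite /represents [lhs](e : lhs = rhs) (rhsP j).
  by move/(congr1 (@unconst (Alg K) (hopf_forget K H1) _)); rewrite !unconst_class.
apply: (_ : lhs = rhs); apply: proHomP => -[[[] []] j].
by rewrite (lhsP j) (rhsP j); have /is_familyE <- := e j.
Qed.
End ProFamilyMaps.

(** * The universal pro-family *)

Definition functor_comp (B C D : category) (G : functor C D) (F : functor B C) : functor B D.
Proof.
refine (@Functor B D (fun x => G (F x)) (fun x y f => fmap G (fmap F f)) _ _).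
- by move=> x; rewrite !fmap_id.
- by move=> x y z g f; rewrite !fmap_comp.
Defined.

Definition functor_id (C : category) : functor C C :=
  @Functor C C id (fun x y f => f) (fun x => erefl) (fun x y z g f => erefl).

(** Transporting arrows between pro-objects of a full subcategory and of the ambient
    category amounts to full faithfulness of the induced functor. *)
Section ProFullyFaithful.
Variables (C D : category) (F : functor C D).
Hypothesis F_full : forall (a b : C) (f : mor (F a) (F b)), exists g, fmap F g = f.
Hypothesis F_faithful : forall (a b : C) (f g : mor a b), fmap F f = fmap F g -> f = g.

Lemma colim_map_inj (X : proObj C) d : injective (@colim_map C D F X d).
Proof.
elim/colim_ind => i f; elim/colim_ind => i' f'.
rewrite !colim_map_class => /germ_classP [k [hi [hi' e]]].
apply/germ_classP; exists k, hi, hi'; apply: F_faithful.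
by rewrite !fmap_comp.
Qed.

Lemma colim_map_surj (X : proObj C) d (c : colim (pro_map_ob F X) (F d)) :
  exists c', colim_map F c' = c.
Proof.
elim/colim_ind: c => i u; have [v vu] := F_full u.
exists (germ_class (Tagged (fun i => mor (X i) d) v)).
by rewrite colim_map_class /germ_map /= vu.
Qed.

Lemma pro_map_faithful (X Y : Pro C) (f g : mor X Y) :
  fmap (pro_map F) f = fmap (pro_map F) g -> f = g.
Proof.
move=> fg; apply: proHomP => j; apply: colim_map_inj.
exact: (congr1 (fun h : proHom (pro_map_ob F X) (pro_map_ob F Y) => sval h j) fg).
Qed.

Lemma pro_map_full (X Y : Pro C) (f : mor (pro_map F X) (pro_map F Y)) :
  exists g : mor X Y, fmap (pro_map F) g = f.
Proof.
pose g j := sval (cid (colim_map_surj (sval f j))).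
have gE j : colim_map F (g j) = sval f j by rewrite /g; case: cid.
have g_tr (j j' : pro_idx Y) (h : dir_le j j') : colim_post (pro_tr h) (g j') = g j.
  by apply: colim_map_inj; rewrite colim_map_post !gE; apply: (svalP f).
by exists (exist _ g g_tr); apply: proHomP => j; apply: gE.
Qed.
End ProFullyFaithful.

Lemma incl_full (C : category) (P : C -> Prop) (a b : fullsub P)
    (f : mor (incl P a) (incl P b)) : exists g, fmap (incl P) g = f.
Proof. by exists f. Qed.

Lemma incl_faithful (C : category) (P : C -> Prop) (a b : fullsub P) (f g : mor a b) :
  fmap (incl P) f = fmap (incl P) g -> f = g.
Proof. by []. Qed.

Section UniversalProAlgebra.
Variable K : fieldType.

Section Classify.
Variables H1 H2 : HopfAlg K.
Local Notation A1 := (hopf_forget K H1 : algebra K).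
Local Notation A2 := (hopf_forget K H2 : algebra K).

Definition postcompose (R S : ComAlg K) (phi : mor R S) (psi : hom_family H1 H2 R) :
    hom_family H1 H2 S :=
  atmap (idm (hopf_forget K H2)) (fmap (incl _) phi) \oc (psi : mor (hopf_forget K H1) _).

Lemma postcompose_comp (R S T : ComAlg K) (v : mor S T) (u : mor R S) psi :
  postcompose v (postcompose u psi) = postcompose (v \oc u) psi.
Proof. by rewrite /postcompose mcompA atmap_comp comp_idl. Qed.

Lemma postcompose_id (R : ComAlg K) (psi : hom_family H1 H2 R) : postcompose (idm R) psi = psi.
Proof. by rewrite /postcompose fmap_id atmap_id comp_idl. Qed.

Definition classify (b : A1 -> seq A2) (R : ComAlg K) (psi : hom_family H1 H2 R)
    (fam : @is_family K H1 H2 R psi) (bpsi : bounded b psi) : mor (universal_ob b) R :=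
  classifying (bounded_coordinatesP fam bpsi).

Lemma classifyE b R psi fam bpsi :
  postcompose (@classify b R psi fam bpsi) (universal_family b) = psi.
Proof. exact: classifyingE. Qed.

Lemma classify_unique (b : A1 -> seq A2) (R : ComAlg K) (phi phi' : mor (universal_ob b) R) :
  postcompose phi (universal_family b) = postcompose phi' (universal_family b) -> phi = phi'.
Proof. exact: classifying_unique. Qed.

(** Inclusion of the values, rather than of their spans, already makes the bounds
    directed, by concatenation, and a larger bound a weaker condition. *)
Definition bounds : directedSet.
Proof.
refine (@DirectedSet (A1 -> seq A2) (fun b b' => forall x, {subset b x <= b' x}) _ _ _ _).
- by move=> b x.
- by move=> b b' b'' bb' b'b'' x u /bb' /b'b''.
- by exists; move=> x; exact: [::].
- by move=> b b'; exists (fun x => b x ++ b' x) => x u; rewrite mem_cat => ->; rewrite ?orbT.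
Defined.

(** The universal family with the smaller bound [b] is also bounded by [b']. *)
Definition transition (b b' : bounds) (h : dir_le b b') : mor (universal_ob b') (universal_ob b) :=
  classify (universal_family_is_family b) (boundedS h (@universal_family_bounded K H1 H2 b)).

Lemma transitionE (b b' : bounds) (h : dir_le b b') :
  postcompose (transition h) (universal_family b') = universal_family b.
Proof. exact: classifyE. Qed.

Lemma transition_id (b : bounds) (h : dir_le b b) : transition h = idm (universal_ob b).
Proof. by apply: classify_unique; rewrite transitionE postcompose_id. Qed.

Lemma transition_comp (b b' b'' : bounds) (h : dir_le b b') (h' : dir_le b' b'') (h'' : dir_le b b'') :
  transition h \oc transition h' = transition h''.
Proof. by apply: classify_unique; rewrite -postcompose_comp !transitionE. Qed.
End Classify.

Section ProUniversal.
Variables (H1 : HopfFg K) (H2 : HopfAlg K).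
Local Notation G1 := (incl _ H1 : HopfAlg K).

Definition universal_cfg (b : bounds G1 H2) : CfgAlg K :=
  @FullObj (ComAlg K) _ (universal_ob b) (universal_alg_fg b (fullvalP H1)).

Definition universal_pro : Pro (CfgAlg K) :=
  @ProObj (CfgAlg K) (bounds G1 H2) universal_cfg (@transition G1 H2)
    (@transition_id G1 H2) (@transition_comp G1 H2).

Local Notation U := (pro_map (incl (fun A : ComAlg K => alg_fg (fullval A))) universal_pro).

(** Over a common larger bound both morphisms classify the same family. *)
Lemma universal_germ_eq (S : ComAlg K) (b b' : pro_idx U)
    (u : mor (@pro_ob _ U b) S) (u' : mor (@pro_ob _ U b') S) :
  postcompose (u : mor (universal_ob b) S) (universal_family b)
  = postcompose (u' : mor (universal_ob b') S) (universal_family b') ->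
  germ_class (Tagged (fun b => mor (@pro_ob _ U b) S) u)
  = germ_class (Tagged (fun b => mor (@pro_ob _ U b) S) u').
Proof.
move=> uu'; have [k bk b'k] := dir_ub b b'.
apply/germ_classP; exists k, bk, b'k; apply: classify_unique.
by rewrite -!postcompose_comp !transitionE.
Qed.

(** Each level of a pro-family is classified over a bound of its own; the classifying
    morphisms are compatible, and the resulting pro-morphism is unique, because
    morphisms that classify the same family have the same germ. *)
Lemma universal_pro_property :
  exists h : mor (hopf_pro G1) (prtensor (hopf_pro H2) (com_pro K U)),
    is_pro_family h /\
    forall (R : Pro (ComAlg K)) (psi : mor (hopf_pro G1) (prtensor (hopf_pro H2) (com_pro K R))),
      is_pro_family psi ->
      exists! phi : mor U R, psi = prmap (idm (hopf_pro H2)) (fmap (com_pro K) phi) \oc h.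
Proof.
have [h hP] := @pro_family_of_levels K G1 H2 U (fun b => universal_family b) (fun b b' le => transitionE le).
have levelE R (phi : mor U R) j b (u : mor (universal_ob b) (@pro_ob _ R j)) :
    @represents _ _ _ phi j b u ->
    level (prmap (idm (hopf_pro H2)) (fmap (com_pro K) phi) \oc h) j
    = postcompose u (universal_family b).
  move=> phiu; have := level_map (idm H2) (idm G1) h phiu.
  by rewrite !fmap_id !comp_idr hP.
exists h; split; first by apply/is_pro_family_level => b; rewrite hP; apply: universal_family_is_family.
move=> R psi /is_pro_family_level fam.
have [b bP] := choice (fun j => exists_bound (level psi j)).
pose phi j := classify (fam j) (bP j).
have phi_tr (j j' : pro_idx R) (le : dir_le j j') :
    colim_post (pro_tr le) (germ_class (Tagged (fun b => mor (@pro_ob _ U b) (@pro_ob _ R j')) (phi j')))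
    = germ_class (Tagged (fun b => mor (@pro_ob _ U b) (@pro_ob _ R j)) (phi j)).
  rewrite colim_post_class; apply: universal_germ_eq.
  by rewrite -postcompose_comp !classifyE; exact: level_tr.
pose Phi : mor U R := exist _ (fun j => germ_class (Tagged (fun b => mor (@pro_ob _ U b) (@pro_ob _ R j)) (phi j))) phi_tr.
have PhiP j : @represents _ _ _ Phi j (b j) (phi j) by [].
exists Phi; split.
  by apply: level_inj => j; rewrite (levelE _ _ _ _ _ (PhiP j)) classifyE.
move=> Phi' psiE; apply: proHomP => j.
have [b' [u Phi'u]] := exists_representative Phi' j.
rewrite (PhiP j) Phi'u; apply: universal_germ_eq.
by rewrite classifyE -(levelE _ _ _ _ _ Phi'u) -psiE.
Qed.
End ProUniversal.

Lemma finite_dim_support (A : algebra K) : alg_fd A ->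
  exists w : seq A, forall (V : lmodType K) (y : tensor A V), supported w y.
Proof.
case=> n [[v2r v2r_lin [r2v v2rK r2vK]]].
exists [seq r2v (delta_mx 0 i) | i <- enum 'I_n] => V y l l0.
have {}l0 u : l u = 0.
  rewrite (_ : u = \sum_(i < n) v2r u 0 i *: r2v (delta_mx 0 i)).
    rewrite linear_sum big1 // => i _; rewrite linearZZ l0; first exact: scaler0.
    by apply/mapP; exists i; rewrite ?mem_enum.
  apply: (can_inj v2rK); rewrite -[RHS]/(linear_of v2r_lin _) linear_sum [LHS]row_sum_delta.
  by apply: eq_bigr => i _; rewrite linearZZ /= r2vK.
elim/tensor_ind: y => [|x y IHx IHy|u v]; first exact: linear0.
  by rewrite linearD IHx IHy addr0.
by rewrite contractE l0 scale0r.
Qed.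

(** In finite dimension a basis of [H2], used as a constant bound, bounds every family. *)
Lemma universal_fd_property (H1 : HopfAlg K) (H2 : HopfFd K) :
  exists (A : ComAlg K)
    (h : mor (hopf_forget K H1) (atensor (hopf_forget K (incl _ H2)) (incl _ A))),
    is_family h /\
    forall (R : ComAlg K)
      (psi : mor (hopf_forget K H1) (atensor (hopf_forget K (incl _ H2)) (incl _ R))),
      is_family psi ->
      exists! phi : mor A R,
        psi = atmap (idm (hopf_forget K (incl _ H2))) (fmap (incl _) phi) \oc h.
Proof.
have [w wP] := finite_dim_support (fullvalP H2).
pose b (x : hopf_forget K H1 : algebra K) : seq (hopf_forget K (incl _ H2) : algebra K) := w.
exists (universal_ob b), (universal_family b); split; first exact: universal_family_is_family.
move=> R psi fam; have bpsi : bounded b psi by move=> x; apply: wP.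
exists (classify fam bpsi); split; first exact: (esym (classifyE fam bpsi)).
by move=> phi psiE; apply: classify_unique; rewrite classifyE.
Qed.
End UniversalProAlgebra.

Theorem theorem5p2 (K : fieldType) :
  (exists (A : functor (prodcat (HopfAlg K) (opcat (HopfFd K))) (ComAlg K))
          (h : forall (H1 : HopfAlg K) (H2 : HopfFd K),
             mor (hopf_forget K H1)
                 (atensor (hopf_forget K (incl _ H2)) (incl _ (A (H1, H2))))),
    [/\ forall H1 H2, is_family (h H1 H2),
        forall (H1 H1' : HopfAlg K) (H2 H2' : HopfFd K)
               (g : mor H1 H1') (f : mor H2' H2),
          atmap (idm (hopf_forget K (incl _ H2)))
                (fmap (incl _) (@fmap _ _ A (H1, H2) (H1', H2') (g, f)))
            \oc h H1 H2
          = atmap (fmap (hopf_forget K) (fmap (incl _) f)) (idm (incl _ (A (H1', H2'))))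
            \oc h H1' H2' \oc fmap (hopf_forget K) g
      & forall (H1 : HopfAlg K) (H2 : HopfFd K) (R : ComAlg K)
               (psi : mor (hopf_forget K H1)
                          (atensor (hopf_forget K (incl _ H2)) (incl _ R))),
          is_family psi ->
          exists! psihat : mor (A (H1, H2)) R,
            psi = atmap (idm (hopf_forget K (incl _ H2))) (fmap (incl _) psihat)
                  \oc h H1 H2])
  /\
  (exists (A : functor (prodcat (HopfFg K) (opcat (HopfAlg K))) (Pro (CfgAlg K)))
          (h : forall (H1 : HopfFg K) (H2 : HopfAlg K),
             mor (hopf_pro (incl _ H1))
                 (prtensor (hopf_pro H2) (com_pro K (pro_map (incl _) (A (H1, H2)))))),
    [/\ forall H1 H2, is_pro_family (h H1 H2),
        forall (H1 H1' : HopfFg K) (H2 H2' : HopfAlg K)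
               (g : mor H1 H1') (f : mor H2' H2),
          prmap (idm (hopf_pro H2))
                (fmap (com_pro K) (fmap (pro_map (incl _))
                   (@fmap _ _ A (H1, H2) (H1', H2') (g, f))))
            \oc h H1 H2
          = prmap (fmap (pro_const (Alg K)) (fmap (hopf_forget K) f))
                  (idm (com_pro K (pro_map (incl _) (A (H1', H2')))))
            \oc h H1' H2'
            \oc fmap (pro_const (Alg K)) (fmap (hopf_forget K) (fmap (incl _) g))
      & forall (H1 : HopfFg K) (H2 : HopfAlg K) (R : Pro (ComAlg K))
               (psi : mor (hopf_pro (incl _ H1)) (prtensor (hopf_pro H2) (com_pro K R))),
          is_pro_family psi ->
          exists! psihat : mor (pro_map (incl _) (A (H1, H2))) R,
            psi = prmap (idm (hopf_pro H2)) (fmap (com_pro K) psihat) \oc h H1 H2]).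
Proof.
split.
  have := @representing_functor (Alg K) (@atensor K) (@atmap K) (@atmap_id K) (@atmap_comp K)
    (HopfAlg K) (HopfFd K) (ComAlg K) (ComAlg K) (hopf_forget K)
    (functor_comp (hopf_forget K) (incl _)) (incl _) (functor_id _).
  move/(_ (fun a b f => ex_intro _ f erefl) (fun a b f g fg => fg)).
  move/(_ (fun H1 H2 R psi => @is_family K H1 (incl _ H2) R psi)).
  apply; last exact: universal_fd_property.
  move=> H1 H1' H2 H2' R g f psi fam.
  exact: (@is_family_map K H1 (incl _ H2) H1' (incl _ H2') R R g f (idm R) psi fam).
have := @representing_functor (Pro (Alg K)) (@prtensor K) (@prmap K) (@prmap_id K) (@prmap_comp K)
    (HopfFg K) (HopfAlg K) (Pro (CfgAlg K)) (Pro (ComAlg K))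
    (functor_comp (pro_const _) (functor_comp (hopf_forget K) (incl _)))
    (functor_comp (pro_const _) (hopf_forget K)) (com_pro K)
    (pro_map (incl (fun A : ComAlg K => alg_fg (fullval A)))).
move/(_ (pro_map_full (@incl_full _ _) (@incl_faithful _ _))).
move/(_ (pro_map_faithful (@incl_faithful _ _))).
move/(_ (fun H1 H2 R psi => @is_pro_family K (incl _ H1) H2 R psi)).
apply; last by move=> H1 H2; exists (universal_pro H1 H2); apply: universal_pro_property.
move=> H1 H1' H2 H2' R g f psi /is_pro_family_level fam; apply/is_pro_family_level => j.
have := level_map f (fmap (incl _) g) psi (@represents_id _ R j).
rewrite fmap_id => ->.
exact: (is_family_map (fmap (incl _) g) f (idm _) (fam j)).
Qed.
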